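(* Let $n\ge3$ be an odd integer and $u=2^n$. For all integers $c_1,c_2$ with $$\frac{4u^2+9}{5}\le c_1\le\frac{11u^2+4}{12}\quad\text{and}\quad\frac{4u^2+9}{5}\le c_2\le\frac{5u^2+4}{6},$$ there exists an AG code over $\mathbb{F}_{u^4}$ with parameters $$\left[4u^4-8u^2-1,\ 4u^4-\frac{33u^2}{4}-5-c_1-c_2,\ d\ge\frac{u^2}{2}+12\right].$$
   Context: A code with parameters $[N,k,d]$ over a finite field $\mathbb{F}$ is a linear subspace of $\mathbb{F}^N$ of dimension $k$ with minimum Hamming distance $d$. An (algebraic geometry) AG code over $\mathbb{F}$ is a code of one of the following forms, where $F/\mathbb{F}$ is a function field with full constant field $\mathbb{F}$, $D=P_1+\dots+P_N$ is a sum of pairwise distinct rational (degree-one) places, and $G$ is a divisor of $F$ with support disjoint from that of $D$: the linear AG code $C_{\mathcal{L}}(D,G)=\{(f(P_1),\dots,f(P_N))\mid f\in\mathcal{L}(G)\}$ with $\mathcal{L}(G)=\{z\in F\mid(z)+G\ge0\}\cup\{0\}$, or the differential AG code $C_\Omega(D,G)=\{(\mathrm{res}_{P_1}(\omega),\dots,\mathrm{res}_{P_N}(\omega))\mid\omega\in\Omega(G-D)\}$, where $\Omega(A)$ is the space of differentials $\omega$ of $F$ with $(\omega)\ge A$, together with $0$. These satisfy $C_{\mathcal{L}}(D,G)^\perp=C_\Omega(D,G)$. *)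

(* Defs.v *)
From HB Require Import structures.
From mathcomp Require Import all_boot all_order all_algebra.
From mathcomp Require Import boolp.
From mathcomp Require Import freeg.

Set Implicit Arguments.
Unset Strict Implicit.
Unset Printing Implicit Defensive.

Import Order.TTheory GRing.Theory Num.Theory.
Local Open Scope ring_scope.

Section FunctionField.

Variables (K : finFieldType) (F : fieldType) (iota : {rmorphism K -> F}).

Definition finite_over_rational (x : F) : Prop :=
  exists (m : nat) (b : 'I_m -> F), forall z : F,
  exists p q : 'I_m -> {poly K},
    (forall i, q i != 0) /\
    z = \sum_(i < m)
          (map_poly iota (p i)).[x] / (map_poly iota (q i)).[x] * b i.

Definition is_function_field : Prop :=
  exists2 x : F, ~ algebraicOver iota x & finite_over_rational x.

Definition full_constant_field : Prop :=
  forall z : F, algebraicOver iota z -> exists a : K, z = iota a.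

(* A place is given by its normalized discrete valuation. As the values are in
   int, the value at 0 (really +oo) is set to 0, so that each place has exactly
   one representative; [vge] below is the comparison that is meaningful at 0. *)
Record place : Type := Place {
  pval :> F -> int;
  pval0 : pval 0 = 0;
  pvalM : forall x y, x != 0 -> y != 0 -> pval (x * y) = pval x + pval y;
  pvalD : forall x y, x != 0 -> y != 0 -> x + y != 0 ->
            Num.min (pval x) (pval y) <= pval (x + y);
  pval_const : forall a : K, a != 0 -> pval (iota a) = 0;
  pval_surj : exists2 t, t != 0 & pval t = 1 }.

HB.instance Definition _ := gen_eqMixin place.
HB.instance Definition _ := gen_choiceMixin place.

(* v_P(z) >= m, with v_P(0) = +oo. The valuation ring of P is [vge P 0] and its
   maximal ideal is [vge P 1]. *)
Definition vge (P : place) (m : int) (z : F) : bool :=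
  (z == 0) || (m <= P z).

(* The residue field of P has a K-basis of size m. *)
Definition place_degree (P : place) (m : nat) : Prop :=
  exists2 e : 'I_m -> F, (forall i, vge P 0 (e i)) &
    forall z, vge P 0 z ->
      exists! a : {ffun 'I_m -> K},
        vge P 1 (z - \sum_(i < m) iota (a i) * e i).

Definition rational_place (P : place) : Prop := place_degree P 1.

(* The residue class f(P), as an element of K (for P rational). *)
Definition value_at (P : place) (f : F) (a : K) : Prop :=
  vge P 0 f && vge P 1 (f - iota a).

Definition divisor := {freeg place / int}.

Definition RR_space (G : divisor) (z : F) : Prop :=
  z <> 0 -> forall P : place, 0 <= P z + coeff P G.

Definition is_derivation (d : F -> F) : Prop :=
  [/\ forall x y, d (x + y) = d x + d y,
      forall x y, d (x * y) = x * d y + y * d x &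
      forall a : K, d (iota a) = 0].

(* The differentials of F form a one-dimensional F-space spanned by the exact
   ones, so each of them has the form u dx; the pair (u, x) stands for u dx,
   and several pairs stand for the same differential. *)
Definition differential := (F * F)%type.

(* u dx = f dt, for t with v_P(t) = 1 at some place P: such a t is separating,
   so that there is exactly one K-derivation d with d t = 1, and dx/dt = d x. *)
Definition diff_coord (t : F) (w : differential) (f : F) : Prop :=
  exists2 d : F -> F, is_derivation d & d t = 1 /\ f = w.1 * d w.2.

Definition uniformizer (P : place) (t : F) : Prop := t != 0 /\ P t = 1.

(* v_P(w) >= m. Neither this nor the residue depends on the uniformizer. *)
Definition diff_vge (P : place) (m : int) (w : differential) : Prop :=
  exists t f, [/\ uniformizer P t, diff_coord t w f & vge P m f].

(* Omega(A), the zero differential included. *)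
Definition Omega_space (A : divisor) (w : differential) : Prop :=
  forall P : place, diff_vge P (coeff P A) w.

(* res_P(w) for P rational: the coefficient of t^-1 in the t-adic expansion of
   w / dt at P. The sequence a lists the coefficients of t^-1, t^-2, ... *)
Definition residue (P : place) (w : differential) (c : K) : Prop :=
  exists t f, [/\ uniformizer P t, diff_coord t w f &
    exists2 a : seq K,
      vge P 0 (f - \sum_(i < size a) iota a`_i / t ^+ i.+1) & c = a`_0].

Section Codes.

Variables (N : nat) (Ps : N.-tuple place) (G : divisor).

Definition points_divisor : divisor := \sum_(i < N) << tnth Ps i >>.

Definition linear_AG_word (c : 'rV[K]_N) : Prop :=
  exists2 f : F, RR_space G f &
    forall i : 'I_N, value_at (tnth Ps i) f (c 0 i).

Definition differential_AG_word (c : 'rV[K]_N) : Prop :=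
  exists2 w : differential, Omega_space (G - points_divisor) w &
    forall i : 'I_N, residue (tnth Ps i) w (c 0 i).

End Codes.

End FunctionField.

Definition is_AG_code (K : finFieldType) (N : nat)
    (C : {vspace 'rV[K]_N}) : Prop :=
  exists (F : fieldType) (iota : {rmorphism K -> F}),
    [/\ is_function_field iota, full_constant_field iota &
    exists (Ps : N.-tuple (place iota)) (G : divisor iota),
      [/\ uniq Ps,
          forall i, rational_place (tnth Ps i),
          forall i, tnth Ps i \notin dom G &
          (forall c, c \in C <-> linear_AG_word Ps G c) \/
          (forall c, c \in C <-> differential_AG_word Ps G c)]].

Definition hamming_distance (K : finFieldType) (N : nat)
    (x y : 'rV[K]_N) : nat := #|[set i | x 0 i != y 0 i]|.

Definition minimum_distance (K : finFieldType) (N : nat)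
    (C : {vspace 'rV[K]_N}) (d : nat) : Prop :=
  (exists x y, [/\ x \in C, y \in C, x != y & hamming_distance x y = d]) /\
  (forall x y, x \in C -> y \in C -> x != y -> (d <= hamming_distance x y)%N).

Definition code_parameters (K : finFieldType) (N : nat)
    (C : {vspace 'rV[K]_N}) (k d : nat) : Prop :=
  \dim C = k /\ minimum_distance C d.

(* Main.v *)
(* The function field can be chosen freely. Put s = u^2, q = s^2 = #|K| and e = 6 s + 1, choose four
   points a_0, ..., a_3 of K and a monic g of degree e vanishing at them, and let F = K(x, y) with
   y^q - y = g(x). All the points (a_l, b) with b in K are rational, and F has a single place at
   infinity, where x and y have poles of the coprime orders q and e; as the affine curve is smooth,
   L(m Pinf) is spanned by the x^i y^j with q i + e j <= m. So the one-point code on a staircase of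
   4 (q - 2 s) - 1 of these points is a Reed-Muller-like code: if f has leading term x^i y^j, then
   f(a_l, .) is nonzero of degree j for at least 4 - i values of l, which gives the weight
   (4 - i) (q - 2 s - j) - 1 at least. The weights q i + e j of the staircase monomials are distinct, so that
   every dimension is attained; counting the monomials of weight > m, the redundancy
   s/4 + 4 + c1 + c2 >= (37 s + 152) / 20 forces this bound to be at least s/2 + 12. *)
From HB Require Import structures.
Require Import Defs.
From mathcomp Require Import all_boot all_order all_algebra.
From mathcomp Require Import all_field boolp freeg zify ring lra.

Set Implicit Arguments.
Unset Strict Implicit.
Unset Printing Implicit Defensive.

Import Order.TTheory GRing.Theory Num.Theory.
Import Pdiv.Ring Pdiv.RingMonic.
Local Open Scope ring_scope.

(** * Weights on K[X][Y] and reduction modulo Y^q - Y - g(X) *)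

(** The curve only carries the grid: its genus is about 3 s^3, far beyond the length, so the degree
    of the divisor says nothing about the distance and the grid argument has to replace it. What
    must be known exactly is L(m Pinf), and the delicate inclusion is that a function with poles
    only at infinity is a polynomial in x and y. Write it as f(x, y) / B(x) with deg_Y f < q. Above
    a root alpha of B, possibly outside K, lie q points of the curve, at each of which f must
    vanish; so f(alpha, Y) is zero and a factor of B cancels. This asks for a place at every
    geometric point; it comes from expanding y in powers of x - alpha, which the Artin-Schreier
    equation makes explicit. As for the weights: with e = c s + 1, coprime to q = s^2, a step in X
    weighs about s / c steps in Y. When the leading monomial has X-degree 0, the other three rows
    add about 6 s / c heavier monomials, so c must not be small; with c = 6, a distance bound of at
    most s/2 + 12 would leave about 3 s / 2 of them or fewer, short of 37 s / 20. *)

Section BivariateEvaluation.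

Variables (K : nzRingType) (A : comNzRingType) (i : {rmorphism K -> A}) (X Y : A).

Definition eval1 : {poly K} -> A := horner_eval X \o map_poly i.
HB.instance Definition _ := GRing.RMorphism.copy eval1 (horner_eval X \o map_poly i).

Definition eval2 : {poly {poly K}} -> A := horner_eval Y \o map_poly eval1.
HB.instance Definition _ := GRing.RMorphism.copy eval2 (horner_eval Y \o map_poly eval1).

Lemma eval1E p : eval1 p = (map_poly i p).[X]. Proof. by []. Qed.

Lemma eval2E f : eval2 f = (map_poly eval1 f).[Y]. Proof. by []. Qed.

Lemma eval1C c : eval1 c%:P = i c.
Proof. by rewrite eval1E map_polyC hornerC. Qed.

Lemma eval1X : eval1 'X = X.
Proof. by rewrite eval1E map_polyX hornerX. Qed.

Lemma eval2C p : eval2 p%:P = eval1 p.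
Proof. by rewrite eval2E map_polyC hornerC. Qed.

Lemma eval2X : eval2 'X = Y.
Proof. by rewrite eval2E map_polyX hornerX. Qed.

Lemma eval1B p r : eval1 (p - r) = eval1 p - eval1 r. Proof. exact: rmorphB. Qed.
Lemma eval1M p r : eval1 (p * r) = eval1 p * eval1 r. Proof. exact: rmorphM. Qed.
Lemma eval1Xn p n : eval1 (p ^+ n) = eval1 p ^+ n. Proof. exact: rmorphXn. Qed.
Lemma eval2_0 : eval2 0 = 0. Proof. exact: rmorph0. Qed.
Lemma eval2_1 : eval2 1 = 1. Proof. exact: rmorph1. Qed.
Lemma eval2D f h : eval2 (f + h) = eval2 f + eval2 h. Proof. exact: rmorphD. Qed.
Lemma eval2B f h : eval2 (f - h) = eval2 f - eval2 h. Proof. exact: rmorphB. Qed.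
Lemma eval2M f h : eval2 (f * h) = eval2 f * eval2 h. Proof. exact: rmorphM. Qed.
Lemma eval2Xn f n : eval2 (f ^+ n) = eval2 f ^+ n. Proof. exact: rmorphXn. Qed.

Lemma eval1_sum p : eval1 p = \sum_(k < size p) i p`_k * X ^+ k.
Proof.
rewrite -[in LHS](coefK p) poly_def rmorph_sum; apply: eq_bigr => k _.
by rewrite -mul_polyC rmorphM rmorphXn /= eval1C eval1X.
Qed.

Lemma eval2_sum f : eval2 f = \sum_(j < size f) eval1 f`_j * Y ^+ j.
Proof.
rewrite -[in LHS](coefK f) poly_def rmorph_sum; apply: eq_bigr => k _.
by rewrite -mul_polyC rmorphM rmorphXn /= eval2C eval2X.
Qed.

End BivariateEvaluation.

Section Composition.

Variables (K : nzRingType) (A B : comNzRingType) (i : {rmorphism K -> A}).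
Variables (h : {rmorphism A -> B}) (k : {rmorphism K -> B}) (X Y : A).
Hypothesis hk : forall c, h (i c) = k c.

Lemma eval1_comp p : h (eval1 i X p) = eval1 k (h X) p.
Proof.
by rewrite !eval1_sum rmorph_sum; apply: eq_bigr => l _; rewrite rmorphM rmorphXn hk.
Qed.

Lemma eval2_comp f : h (eval2 i X Y f) = eval2 k (h X) (h Y) f.
Proof.
rewrite !eval2_sum rmorph_sum; apply: eq_bigr => j _.
by rewrite rmorphM rmorphXn eval1_comp.
Qed.

End Composition.

Section Weights.

Variables (K : finFieldType) (e : nat).
Local Notation q := #|K|.
Hypothesis co_qe : coprime q e.

(** The outer variable is Y and the inner one is X. The weights q of X and e of Y are the pole
    orders of x and y at infinity. *)
Definition wle (m : nat) (f : {poly {poly K}}) :=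
  forall i j, f`_j`_i != 0 -> (q * i + e * j <= m)%N.

Lemma wle_mono m n f : (m <= n)%N -> wle m f -> wle n f.
Proof. by move=> mn fm i j /fm fij; exact: leq_trans fij mn. Qed.

Lemma wleD m f h : wle m f -> wle m h -> wle m (f + h).
Proof.
move=> fm hm i j; rewrite !coefD; have [fz|/fm//] := eqVneq (f`_j`_i) 0.
by rewrite fz add0r => /hm.
Qed.

Lemma wleN m f : wle m f -> wle m (- f).
Proof. by move=> fm i j; rewrite !coefN oppr_eq0 => /fm. Qed.

Lemma wle_sum m (I : Type) (r : seq I) (Q : pred I) (F : I -> {poly {poly K}}) :
  (forall i, Q i -> wle m (F i)) -> wle m (\sum_(i <- r | Q i) F i).
Proof.
move=> Fm; elim/big_rec: _ => [i j|i f Qi fm]; first by rewrite !coef0 eqxx.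
exact: wleD (Fm i Qi) fm.
Qed.

Lemma wleM m n f h : wle m f -> wle n h -> wle (m + n) (f * h).
Proof.
move=> fm hn i j; rewrite coefM coef_sum => nz.
have /existsP[k nzk] : [exists k : 'I_j.+1, (f`_k * h`_(j - k))`_i != 0].
  apply: contraNT nz; rewrite negb_exists => /forallP nz.
  by rewrite big1 // => k _; apply/eqP; move/negPn: (nz k).
move: nzk; rewrite coefM => nzk.
have /existsP[l] : [exists l : 'I_i.+1, f`_k`_l * h`_(j - k)`_(i - l) != 0].
  apply: contraNT nzk; rewrite negb_exists => /forallP nz'.
  by rewrite big1 // => l _; apply/eqP; move/negPn: (nz' l).
rewrite mulf_eq0 negb_or => /andP[/fm fkl /hn hkl].
have := leq_add fkl hkl; have := ltn_ord k; have := ltn_ord l; rewrite !ltnS => li kj.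
by rewrite addnACA -!mulnDr !subnKC.
Qed.

Lemma coef_monom2 (c : K) i j i' j' :
  ((c *: 'X^i)%:P * 'X^j : {poly {poly K}})`_j'`_i' = if (i' == i) && (j' == j) then c else 0.
Proof.
have E : (c *: 'X^i)%:P * 'X^j = c *: 'X^i *: 'X^j :> {poly {poly K}} by rewrite mul_polyC.
rewrite E coefZ coefXn andbC; case: eqP => _; last by rewrite mulr0 coef0.
by rewrite mulr1 coefZ coefXn; case: eqP; rewrite ?mulr1 ?mulr0.
Qed.

(* The leading form of the curve for the weights (q, e) is Y^q - X^e, which vanishes at (t^q, t^e). *)
Definition lead_form : {poly {poly K}} -> {poly K} := eval2 polyC 'X^q 'X^e.

Lemma lead_formE f :
  lead_form f = \sum_(j < size f) \sum_(i < size f`_j) f`_j`_i *: 'X^(q * i + e * j).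
Proof.
rewrite /lead_form eval2_sum; apply: eq_bigr => j _; rewrite eval1_sum mulr_suml.
by apply: eq_bigr => i _; rewrite mul_polyC -scalerAl -!exprM -exprD.
Qed.

Lemma size_lead_form m f : wle m f -> (size (lead_form f) <= m.+1)%N.
Proof.
move=> fm; rewrite lead_formE; apply: (leq_trans (size_sum _ _ _)).
apply/bigmax_leqP => j _; apply: (leq_trans (size_sum _ _ _)).
apply/bigmax_leqP => i _; have [->|/fm ijm] := eqVneq (f`_j`_i) 0.
  by rewrite scale0r size_poly0.
by rewrite (leq_trans (size_scale_leq _ _)) // size_polyXn ltnS.
Qed.

(** Equal weights make q divide e (j' - j), hence j' - j by coprimality, while 0 <= j' - j < q. So
    the monomials of a remainder modulo the curve never cancel one another at infinity. *)
Lemma weight_inj i j i' j' : (j < q)%N -> (j' < q)%N ->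
  (q * i + e * j = q * i' + e * j')%N -> i = i' /\ j = j'.
Proof.
wlog jj' : i j i' j' / (j <= j')%N => [hw jq j'q E|jq j'q E].
  case/orP: (leq_total j j') => h; first exact: hw.
  by have [-> ->] := hw i' j' i j h j'q jq (esym E); split.
have q_dvd : (q %| e * (j' - j))%N.
  by apply/dvdnP; exists (i - i')%N; rewrite mulnBr mulnBl; lia.
rewrite Gauss_dvdr // in q_dvd.
have j0 : (j' - j = 0)%N.
  by apply/eqP; rewrite -leqn0 leqNgt; apply/negP => /dvdn_leq/(_ q_dvd); lia.
have jE : j = j' by lia.
by subst j'; split=> //; apply/eqP; rewrite -(eqn_pmul2l (m := q)); lia.
Qed.

Lemma coef_lead_form (f : {poly {poly K}}) i j : (size f <= q)%N -> (j < q)%N ->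
  (lead_form f)`_(q * i + e * j) = f`_j`_i.
Proof.
move=> fq jq; rewrite lead_formE coef_sum.
under eq_bigr => k _ do rewrite coef_sum.
have term (k l : nat) : (k < q)%N -> (f`_k`_l *: 'X^(q * l + e * k) : {poly K})`_(q * i + e * j) =
    if (l == i) && (k == j) then f`_j`_i else 0.
  move=> kq; rewrite coefZ coefXn; case: eqP => [/weight_inj[//|//|-> ->]|ne].
    by rewrite !eqxx mulr1.
  rewrite mulr0; case: andP => // -[/eqP li /eqP kj]; case: ne; by rewrite li kj.
have [jf|fj] := ltnP j (size f); last first.
  rewrite (nth_default _ fj) coef0 big1 // => k _; rewrite big1 // => l _.
  rewrite term ?(leq_trans (ltn_ord k)) // (nth_default _ fj) coef0.
  by case: ifP.
rewrite (bigD1 (Ordinal jf)) //= [X in _ + X]big1 ?addr0 => [|k kj]; last first.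
  rewrite big1 // => l _; rewrite term ?(leq_trans (ltn_ord k)) //.
  by rewrite (negPf (_ : k != j :> nat)) ?andbF //; apply: contra kj => /eqP kj; apply/eqP/val_inj.
have [ifj|fji] := ltnP i (size f`_j); last first.
  rewrite (nth_default _ fji) big1 // => l _; rewrite term // (nth_default _ fji).
  by case: ifP.
rewrite (bigD1 (Ordinal ifj)) //= term // !eqxx /= big1 ?addr0 // => l li.
rewrite term // (negPf (_ : l != i :> nat)) //.
Qed.

Lemma lead_form_eq0 (f : {poly {poly K}}) : (size f <= q)%N -> lead_form f = 0 -> f = 0.
Proof.
move=> fq f0; apply/polyP => j; apply/polyP => i; rewrite !coef0.
have [jq|qj] := ltnP j q; last by rewrite [f`_j]nth_default ?coef0 // (leq_trans fq qj).
by rewrite -coef_lead_form // f0 coef0.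
Qed.

Lemma wle_lead_form m (f : {poly {poly K}}) : (size f <= q)%N -> (size (lead_form f) <= m.+1)%N -> wle m f.
Proof.
move=> fq fm i j nz; have jq : (j < q)%N.
  by rewrite ltnNge; apply: contra nz => qj; rewrite [f`_j]nth_default ?coef0 // (leq_trans fq qj).
rewrite -ltnS (leq_trans _ fm) // ltnNge; apply: contra nz => /leq_sizeP h.
by rewrite -coef_lead_form // h.
Qed.

End Weights.

(** * The weighted degree on the coordinate ring of the curve *)

Section Curve.

Variables (K : finFieldType) (g : {poly K}) (e : nat).
Local Notation q := #|K|.
Hypotheses (g_monic : g \is monic) (size_g : size g = e.+1) (e_gt0 : (0 < e)%N).
Hypothesis co_qe : coprime q e.

Definition curve : {poly {poly K}} := 'X^q - 'X - g%:P.

Local Notation wle := (wle e).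
Local Notation lead_form := (lead_form e).

Let q_gt1 : (1 < q)%N := finNzRing_gt1 K.

Lemma size_curve_tail : (size ('X + g%:P : {poly {poly K}})%R <= 2)%N.
Proof. by rewrite (leq_trans (size_polyD _ _)) // geq_max size_polyX (leq_trans (size_polyC_leq1 _)). Qed.

Lemma size_curve : size curve = q.+1.
Proof.
rewrite /curve -addrA -opprD size_polyDl ?size_polyXn // size_polyN.
exact: leq_ltn_trans size_curve_tail _.
Qed.

Lemma curve_monic : curve \is monic.
Proof.
rewrite /curve -addrA -opprD monicE lead_coefDl ?lead_coefXn //.
by rewrite size_polyXn size_polyN; exact: leq_ltn_trans size_curve_tail _.
Qed.

Lemma wle_curve : wle (e * q) curve.
Proof.
have g_le i : g`_i != 0 -> (i <= e)%N.
  by move=> gi; rewrite -ltnS -size_g ltnNge; apply: contra gi => /leq_sizeP ->.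
rewrite /curve; apply: wleD; first apply: wleD.
- move=> i j; rewrite coefXn; case: (j =P q) => [->|_]; last by rewrite coef0 eqxx.
  by rewrite coef1; case: (i =P 0%N) => [->|]; rewrite ?eqxx // muln0.
- apply: wleN => i j; rewrite coefX; case: (j =P 1%N) => [->|_]; last by rewrite coef0 eqxx.
  rewrite coef1; case: (i =P 0%N) => [->|]; rewrite ?eqxx // muln0 => _.
  by rewrite leq_pmul2l // ltnW.
- apply: wleN => i j; rewrite coefC; case: (j =P 0%N) => [->|_]; last by rewrite coef0 eqxx.
  by move=> /g_le ie; rewrite muln0 addn0 mulnC leq_pmul2r // ltnW.
Qed.

(** The strict drop of the degree below e q is the point: Y contributes only t^e, and the lower
    terms of g stay below q e. Subtracting a multiple of the curve therefore leaves the top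
    coefficient of a leading form unchanged. *)
Lemma size_lead_form_curve : (size (lead_form curve) <= e * q)%N.
Proof.
have gE : g = 'X^e + (g - 'X^e) by rewrite addrC subrK.
have size_tail : (size (g - 'X^e)%R <= e)%N.
  apply/leq_sizeP => j; rewrite leq_eqVlt => /predU1P[<-|ej].
    have /monicP := g_monic; rewrite lead_coefE size_g /= coefB coefXn eqxx => ->.
    by rewrite subrr.
  by rewrite coefB coefXn gtn_eqF // nth_default ?size_g // subrr.
have -> : lead_form curve = - 'X^e - lead_form (g - 'X^e)%:P.
  rewrite /curve {1}gE; move: (g - 'X^e) => t; rewrite polyCD polyC_exp.
  rewrite /lead_form !(eval2B, eval2D, eval2Xn) !eval2X eval2C eval1X -!exprM mulnC.
  by rewrite opprD addrACA subrr add0r.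
rewrite (leq_trans (size_polyD _ _)) // geq_max !size_polyN size_polyXn.
have qe : (e < e * q)%N by rewrite ltn_Pmulr.
suff /size_lead_form : wle (e * q).-1 (g - 'X^e)%:P by rewrite qe prednK // (leq_trans _ qe).
move=> i j; rewrite coefC; case: (j =P 0%N) => [->|_]; last by rewrite coef0 eqxx.
move=> nz; rewrite muln0 addn0; have ie : (i < e)%N.
  by rewrite ltnNge; apply: contra nz => ei; rewrite nth_default // (leq_trans size_tail).
have : (q * i < e * q)%N by rewrite mulnC ltn_pmul2r // ltnW.
by case: (e * q)%N.
Qed.

(** Division by the monic curve, one leading Y-term at a time: each subtracted multiple has weight
    at most m, and its leading form has degree below m. *)
Lemma wle_rmodp m (f : {poly {poly K}}) : wle m f ->
  wle m (rmodp f curve) /\ (lead_form (rmodp f curve))`_m = (lead_form f)`_m.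
Proof.
have [n] := ubnP (size f); elim: n f => // n IHn f /ltnSE fn fm.
have [fq|qf] := ltnP (size f) (size curve); first by rewrite rmodp_small.
have f_gt0 : (0 < size f)%N by rewrite (leq_trans _ qf) // size_curve.
have f_nz : f != 0 by rewrite -size_poly_gt0.
rewrite size_curve in qf.
set k := ((size f).-1 - q)%N; set l := lead_coef f.
have kE : (k + q)%N = (size f).-1 by rewrite subnK // -ltnS prednK.
pose c := l%:P * 'X^k : {poly {poly K}}.
have [m' mE] : exists m', m = (m' + e * q)%N.
  exists (m - e * q)%N; rewrite subnK //.
  have [i li] : exists i, l`_i != 0.
    exists (size l).-1; rewrite -lead_coefE lead_coef_eq0 lead_coef_eq0 //.
  by have := fm i _ li; rewrite -kE; nia.
have c_wle : wle m' c.
  move=> i j; rewrite /c coefMXn; case: ltnP => [_|kj]; first by rewrite coef0 eqxx.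
  rewrite coefC subn_eq0; case: leqP => [jk|_]; last by rewrite coef0 eqxx.
  by move=> /fm; rewrite -kE (_ : j = k); nia.
pose f' := f - c * curve.
have f'_wle : wle m f' by apply: wleD fm (wleN _); rewrite mE; exact: wleM c_wle wle_curve.
have size_c : size (c * curve) = size f.
  rewrite size_Mmonic ?curve_monic // ?size_curve.
    by rewrite /c size_mulXn ?polyC_eq0 ?lead_coef_eq0 // size_polyC lead_coef_eq0 f_nz; lia.
  by rewrite /c mulf_neq0 // ?polyC_eq0 ?lead_coef_eq0 // monic_neq0 ?monicXn.
have f'_small : (size f' < n)%N.
  rewrite (leq_trans _ fn) // -[size f]prednK // ltnS; apply/leq_sizeP => j.
  rewrite leq_eqVlt => /predU1P[<-|fj]; last first.
    by rewrite coefB !nth_default ?subr0 ?size_c // -[size f]prednK.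
  rewrite coefB -lead_coefE -size_c -lead_coefE lead_coef_Mmonic ?curve_monic //.
  by rewrite /c lead_coef_Mmonic ?monicXn // lead_coefC subrr.
have [f'w f'c] := IHn _ f'_small f'_wle.
have -> : rmodp f curve = rmodp f' curve.
  by rewrite /f' rmodpB ?curve_monic // rmodp_mull ?curve_monic // subr0.
split=> //; rewrite f'c /f' /lead_form eval2B eval2M coefB [X in _ - X](_ : _ = 0) ?subr0 //.
apply: nth_default; rewrite (leq_trans (size_polyMleq _ _)) // mE.
have := leq_add (size_lead_form c_wle) size_lead_form_curve; rewrite addSn /lead_form /= => h.
by case: (_ + _)%N h.
Qed.

(** This becomes the pole order at infinity. Multiples of the curve get the default value 0, which
    is harmless in bounds of the form [wdeg f <= m]. *)
Definition wdeg (f : {poly {poly K}}) := (size (lead_form (rmodp f curve))).-1.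

Lemma size_rmodp_curve (f : {poly {poly K}}) : (size (rmodp f curve) <= q)%N.
Proof. by rewrite -ltnS -size_curve ltn_rmodpN0 // monic_neq0 ?curve_monic. Qed.

Lemma wdeg_rmodp f : wdeg (rmodp f curve) = wdeg f.
Proof. by rewrite /wdeg rmodp_id ?curve_monic. Qed.

Lemma wle_wdeg f : wle (wdeg f) (rmodp f curve).
Proof. apply: (wle_lead_form co_qe); [exact: size_rmodp_curve | exact: leqSpred]. Qed.

Lemma wdeg_le m f : wle m f -> (wdeg f <= m)%N.
Proof.
move=> /wle_rmodp[/size_lead_form fm _].
by rewrite /wdeg; case: size fm.
Qed.
 
(** Leading forms live in the domain K[t], so their product has a nonzero coefficient in degree
    [wdeg f + wdeg h], and it survives the reduction. Absence of zero divisors and additivity of the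
    degree come together. *)
Lemma rmodp_curveM f h : rmodp f curve != 0 -> rmodp h curve != 0 ->
  rmodp (f * h) curve != 0 /\ wdeg (f * h) = (wdeg f + wdeg h)%N.
Proof.
move=> fnz hnz; set F := rmodp f curve; set H := rmodp h curve.
have lead_nz f1 : rmodp f1 curve != 0 -> lead_form (rmodp f1 curve) != 0.
  by apply: contraNneq => /(lead_form_eq0 co_qe) ->; rewrite ?size_rmodp_curve.
have E : rmodp (f * h) curve = rmodp (F * H) curve.
  by rewrite rmodp_mulmr ?curve_monic // rmodp_mulml ?curve_monic.
have [w c] := wle_rmodp (wleM (@wle_wdeg f) (@wle_wdeg h)).
have c_nz : (lead_form (rmodp (f * h) curve))`_(wdeg f + wdeg h) != 0.
  rewrite E c /lead_form eval2M -!/(lead_form _); set u := lead_form F; set v := lead_form H.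
  have u_nz : u != 0 := lead_nz _ fnz; have v_nz : v != 0 := lead_nz _ hnz.
  rewrite (_ : (wdeg f + wdeg h)%N = (size (u * v)%R).-1).
    by rewrite -lead_coefE lead_coef_eq0 mulf_neq0.
  have [-> ->] : wdeg f = (size u).-1 /\ wdeg h = (size v).-1 by [].
  rewrite size_mul //; move: u_nz v_nz; rewrite -!size_poly_gt0.
  by case: (size u) (size v) => // a [] // b _ _; rewrite addSn addnS.
split; first by apply: contraNneq c_nz => ->; rewrite /lead_form eval2_0 coef0.
apply/eqP; rewrite eqn_leq; apply/andP; split.
  by rewrite -wdeg_rmodp E wdeg_rmodp; apply: wdeg_le; apply: wleM; apply: wle_wdeg.
rewrite leqNgt; apply: contra c_nz => lt; apply/eqP/nth_default.
by rewrite /wdeg in lt; case: size lt.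
Qed.

End Curve.

(** * The function field of the curve *)

Lemma fraction_numden (R : idomainType) (a : {fraction R}) :
  exists n d : R, d != 0 /\ a = FracField.tofrac n / FracField.tofrac d.
Proof.
elim/quotW: a => r; exists (\n_r), (\d_r); split; first exact: denom_ratioP.
have nz : FracField.tofrac \d_r != 0 by rewrite tofrac_eq0 denom_ratioP.
apply: (canRL (mulfK nz)); rewrite !piE; apply/eqmodP.
rewrite /= FracField.equivfE /FracField.mulf !numden_Ratio ?mulf_neq0 ?oner_eq0 ?denom_ratioP //.
by rewrite !mulr1 mulrC.
Qed.

Lemma clear_denominators (R : idomainType) (p : {poly {fraction R}}) :
  exists c : R, exists p0 : {poly R}, [/\ c != 0, size p0 = size p &
    FracField.tofrac c *: p = map_poly (@FracField.tofrac R) p0].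
Proof.
suff [c [p0 [c_nz E]]] : exists c : R, exists p0 : {poly R}, c != 0 /\
    FracField.tofrac c *: p = map_poly (@FracField.tofrac R) p0.
  exists c, p0; split=> //.
  rewrite -(size_scale (a := FracField.tofrac c)) ?tofrac_eq0 // E size_map_inj_poly ?rmorph0 //.
  by move=> u v /eqP; rewrite tofrac_eq => /eqP.
elim/poly_ind: p => [|p a [c [p0 [c_nz E]]]].
  by exists 1, 0; rewrite oner_neq0 scaler0 rmorph0.
have [n [d [d_nz ->]]] := fraction_numden a.
exists (c * d), (d *: p0 * 'X + (c * n)%:P); split; first by rewrite mulf_neq0.
rewrite rmorphD /= map_polyC /=.
rewrite [X in _ = X + _](_ : _ = FracField.tofrac d *: (FracField.tofrac c *: p) * 'X); last first.
  by rewrite E rmorphM /= map_polyX map_polyZ.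
rewrite scalerDr scalerA -scalerAl -rmorphM [(d * c)%R]mulrC; congr (_ + _).
rewrite -mul_polyC -polyCM; congr (_%:P).
by rewrite !rmorphM mulrACA divff ?mulr1 ?tofrac_eq0.
Qed.

Section CurveField.

Variables (K : finFieldType) (g : {poly K}) (e : nat).
Local Notation q := #|K|.
Local Notation curve := (curve g).
Hypotheses (g_monic : g \is monic) (size_g : size g = e.+1) (e_gt0 : (0 < e)%N).
Hypothesis co_qe : coprime q e.

(** A description of K(x, y) on which everything below relies, instead of on its construction. Only
    x occurs in denominators, which prepares the descent on B in [regular_ev]. *)
Definition is_curve_field (F : fieldType) (iota : {rmorphism K -> F}) (x y : F) : Prop :=
  [/\ eval2 iota x y curve = 0,
      forall z, exists (f : {poly {poly K}}) (B : {poly K}), [/\ (size f <= q)%N, B != 0 & z = eval2 iota x y f / eval1 iota x B] &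
      forall f : {poly {poly K}}, (size f <= q)%N -> eval2 iota x y f = 0 -> f = 0].

Local Notation k := {fraction {poly K}}.
Local Notation tofrac := (@FracField.tofrac {poly K}).

Let q_gt1 : (1 < q)%N := finNzRing_gt1 K.

Let size_tofrac (f : {poly {poly K}}) : size (map_poly tofrac f) = size f.
Proof.
rewrite size_map_inj_poly ?rmorph0 //.
by move=> u v /eqP; rewrite tofrac_eq => /eqP.
Qed.

(** After clearing denominators, a proper factorization over K(X) gives two nonzero polynomials of
    Y-degree below q whose product is a multiple of the curve; [rmodp_curveM] forbids this. *)
Lemma curve_irreducible : irreducible_poly (map_poly tofrac curve).
Proof.
split=> [|d size_d /dvdpP[d' E]]; first by rewrite size_tofrac size_curve // ltnS ltnW.
have nz : map_poly tofrac curve != 0.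
  by rewrite -size_poly_gt0 size_tofrac size_curve.
have [d_nz d'_nz] : d != 0 /\ d' != 0.
  by split; apply: contraNneq nz => z; rewrite E z ?mulr0 ?mul0r.
have size_sum : (size d' + size d).-1 = q.+1.
  by rewrite -size_mul // -E size_tofrac size_curve.
have [size_d'|d'_gt1] := leqP (size d') 1.
  have [a a_nz Ed'] : exists2 a, a != 0 & d' = a%:P.
    by have /size1_polyC Ed' := size_d'; exists d'`_0; rewrite // -polyC_eq0 -Ed'.
  by rewrite E Ed' mul_polyC eqp_sym eqp_scale.
have size_d_gt0 : (0 < size d)%N by rewrite size_poly_gt0.
have [c [p0 [c_nz size_p0 Ep]]] := clear_denominators d.
have [c' [p0' [c'_nz size_p0' Ep']]] := clear_denominators d'.
have Ecurve : (c' * c)%:P * curve = p0' * p0.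
  apply: (map_inj_poly (f := tofrac)); rewrite ?rmorph0 //.
    by move=> u v /eqP; rewrite tofrac_eq => /eqP.
  rewrite [RHS]rmorphM /= -Ep -Ep' rmorphM /= E map_polyC /= rmorphM polyCM -!mul_polyC.
  by rewrite mulrACA.
have small : (size p0 <= q)%N /\ (size p0' <= q)%N.
  rewrite size_p0 size_p0'; have d_gt1 : (1 < size d)%N by rewrite ltn_neqAle eq_sym size_d.
  by move: size_sum d'_gt1 d_gt1; move: (size d) (size d') #|K| => a b Q; lia.
have red (f : {poly {poly K}}) : (size f <= q)%N -> rmodp f curve = f.
  by move=> fq; rewrite rmodp_small // size_curve.
have nzp : rmodp p0 curve != 0 by rewrite red ?small.1 // -size_poly_gt0 size_p0.
have nzp' : rmodp p0' curve != 0.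
  by rewrite red ?small.2 // -size_poly_gt0 size_p0' size_poly_gt0.
have [] := rmodp_curveM g_monic size_g e_gt0 co_qe nzp' nzp.
by rewrite -Ecurve rmodp_mull ?curve_monic // eqxx.
Qed.

Lemma eval1_rmorph (A : comNzRingType) (i : {rmorphism K -> A}) (h : {rmorphism {poly K} -> A}) p :
  (forall c, i c = h c%:P) -> eval1 i (h 'X) p = h p.
Proof.
move=> ih; rewrite eval1_sum -[in RHS](coefK p) poly_def rmorph_sum.
by apply: eq_bigr => j _; rewrite -mul_polyC rmorphM rmorphXn ih.
Qed.

Lemma curve_field_exists : exists (F : fieldType) (iota : {rmorphism K -> F}) (x y : F),
  is_curve_field iota x y.
Proof.
have [F _ [y y_root F_gen]] := irredp_FAdjoin curve_irreducible.
pose h : {rmorphism {poly K} -> F} := in_alg F \o tofrac.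
pose iota : {rmorphism K -> F} := h \o polyC.
exists F, iota, (h 'X), y.
have ev1 p : eval1 iota (h 'X) p = in_alg F (tofrac p) by exact: eval1_rmorph.
have ev2 f : eval2 iota (h 'X) y f = (map_poly (in_alg F) (map_poly tofrac f)).[y].
  by rewrite eval2E -map_poly_comp; congr horner; apply: eq_map_poly => p; exact: ev1.
have curve0 : eval2 iota (h 'X) y curve = 0 by rewrite ev2; exact/rootP.
have curve_nz : curve != 0 by rewrite monic_neq0 ?curve_monic.
split=> // [z|f fq f0].
  have : z \in <<1; y>>%VS by rewrite F_gen memvf.
  case/Fadjoin1_polyP => p ->.
  have [c [p0 [c_nz size_p0 Ep]]] := clear_denominators p.
  exists (rmodp p0 curve), c; split=> //; first exact: size_rmodp_curve.
  have -> : eval2 iota (h 'X) y (rmodp p0 curve) = eval2 iota (h 'X) y p0.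
    by rewrite [in RHS](rdivp_eq (curve_monic g) p0) eval2D eval2M curve0 mulr0 add0r.
  rewrite ev1 ev2 -Ep map_polyZ hornerZ mulrAC divff ?mul1r //.
  by rewrite fmorph_eq0 tofrac_eq0.
apply/eqP; apply: contraTT isT => f_nz.
set f' := map_poly tofrac f; set c' := map_poly tofrac curve.
have f'_nz : f' != 0 by rewrite -size_poly_gt0 size_tofrac size_poly_gt0.
have co : coprimep f' c'.
  rewrite /coprimep; apply: contraT => /(curve_irreducible)/(_ (dvdp_gcdr _ _)) E.
  have : c' %| f' by rewrite -(eqp_dvdl _ E) dvdp_gcdl.
  by move=> /dvdp_leq -/(_ f'_nz); rewrite !size_tofrac size_curve // ltnNge fq.
have cop : coprimep (map_poly (in_alg F) f') (map_poly (in_alg F) c') by rewrite coprimep_map.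
have f'_root : root (map_poly (in_alg F) f') y by rewrite rootE -ev2 f0.
by have := coprimep_root cop f'_root; rewrite -ev2 curve0 eqxx.
Qed.

End CurveField.

(** * Valuations *)

Section Frobenius.

Variables (K : finFieldType) (A : comNzRingType) (i : {rmorphism K -> A}).
Local Notation q := #|K|.

Lemma pchar_nat_card : [pchar A].-nat q.
Proof.
have [p p_pr pK] := finPcharP K.
have pA : p \in [pchar A] := rmorph_pchar i pK.
rewrite (eq_pnat _ (pcharf_eq pA)).
by have := pprimeChar_pgroup pK; rewrite /pgroup.pgroup cardsT.
Qed.

Lemma FrobD (x y : A) m : (x + y) ^+ (q ^ m) = x ^+ (q ^ m) + y ^+ (q ^ m).
Proof. by rewrite exprDn_pchar // pnatX pchar_nat_card. Qed.

Lemma FrobN (x : A) m : (- x) ^+ (q ^ m) = - x ^+ (q ^ m).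
Proof. by rewrite exprNn_pchar // pnatX pchar_nat_card. Qed.

Lemma FrobB (x y : A) m : (x - y) ^+ (q ^ m) = x ^+ (q ^ m) - y ^+ (q ^ m).
Proof. by rewrite FrobD FrobN. Qed.

Lemma Frob_sum (I : Type) (r : seq I) (F : I -> A) m :
  (\sum_(k <- r) F k) ^+ (q ^ m) = \sum_(k <- r) F k ^+ (q ^ m).
Proof.
apply: (big_morph (fun x => x ^+ (q ^ m)) (fun x y => FrobD x y m)).
by rewrite expr0n expn_eq0 andbC; case: m => //= m; have := finNzRing_gt1 K; case: (#|K|).
Qed.

Lemma Frob_const (c : K) m : i c ^+ (q ^ m) = i c.
Proof.
elim: m => [|m IH]; first by rewrite expr1.
by rewrite expnS exprM -rmorphXn expf_card.
Qed.

End Frobenius.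

Section PlaceTheory.

Variables (K : finFieldType) (F : fieldType) (iota : {rmorphism K -> F}) (P : place iota).

Lemma vge0 m : vge P m 0. Proof. by rewrite /vge eqxx. Qed.

Lemma vge_mono (m n : int) z : m <= n -> vge P n z -> vge P m z.
Proof. by move=> mn /orP[/eqP->|nz]; rewrite ?vge0 // /vge (le_trans mn nz) orbT. Qed.

Lemma vgeE m z : z != 0 -> vge P m z = (m <= P z).
Proof. by rewrite /vge => /negPf ->. Qed.

Lemma vgeD m z1 z2 : vge P m z1 -> vge P m z2 -> vge P m (z1 + z2).
Proof.
have [->|nz1] := eqVneq z1 0; first by rewrite add0r.
have [->|nz2] := eqVneq z2 0; first by rewrite addr0.
have [->|nz] := eqVneq (z1 + z2) 0; first by rewrite vge0.
rewrite !vgeE // => h1 h2; apply: le_trans (pvalD P nz1 nz2 nz).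
by rewrite le_min h1.
Qed.

Lemma vgeM m n z1 z2 : vge P m z1 -> vge P n z2 -> vge P (m + n) (z1 * z2).
Proof.
have [->|nz1] := eqVneq z1 0; first by move=> _ _; rewrite mul0r vge0.
have [->|nz2] := eqVneq z2 0; first by move=> _ _; rewrite mulr0 vge0.
by rewrite !vgeE ?mulf_neq0 // pvalM // => h1 h2; exact: lerD.
Qed.

Lemma vge_const (a : K) : vge P 0 (iota a).
Proof.
have [->|nz] := eqVneq a 0; first by rewrite rmorph0 vge0.
by rewrite /vge pval_const // lexx orbT.
Qed.

Lemma pval1 : P 1 = 0.
Proof. by rewrite -(rmorph1 iota) pval_const ?oner_neq0. Qed.

Lemma pvalN z : P (- z) = P z.
Proof.
have [->|nz] := eqVneq z 0; first by rewrite oppr0.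
rewrite -mulN1r pvalM // ?oppr_eq0 ?oner_eq0 //.
by rewrite -(rmorph1 iota) -rmorphN pval_const ?add0r // oppr_eq0 oner_neq0.
Qed.

Lemma vgeN m z : vge P m (- z) = vge P m z.
Proof. by rewrite /vge oppr_eq0 pvalN. Qed.

Lemma vge_sum m (I : Type) (r : seq I) (Q : pred I) (G : I -> F) :
  (forall k, Q k -> vge P m (G k)) -> vge P m (\sum_(k <- r | Q k) G k).
Proof.
by move=> h; elim/big_rec: _ => [|k z Qk]; [exact: vge0 | exact: vgeD (h k Qk)].
Qed.

Lemma pvalX z n : z != 0 -> P (z ^+ n) = n%:Z * P z.
Proof.
move=> nz; elim: n => [|n IH]; first by rewrite expr0 pval1 mul0r.
by rewrite exprS pvalM ?expf_neq0 // IH -add1n PoszD mulrDl mul1r.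
Qed.

Lemma pvalV z : z != 0 -> P z^-1 = - P z.
Proof.
move=> nz; apply/eqP; rewrite -addr_eq0 -pvalM ?invr_neq0 // mulVf //.
by rewrite pval1.
Qed.

(** Recovering z1 as (z1 + z2) - z2 excludes a larger valuation of the sum. Using [vge] in the
    hypothesis lets z2 be 0. *)
Lemma pval_dominant z1 z2 : z1 != 0 -> vge P (P z1 + 1) z2 ->
  z1 + z2 != 0 /\ P (z1 + z2) = P z1.
Proof.
move=> nz1 h2.
have nz : z1 + z2 != 0.
  apply: contraTneq h2 => /eqP; rewrite addrC addr_eq0 => /eqP ->.
  by rewrite vgeN vgeE // gerDl ler10.
split=> //; apply/eqP; rewrite eq_le; apply/andP; split; last first.
  rewrite -vgeE //; apply: vgeD; first by rewrite vgeE.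
  by apply: vge_mono h2; rewrite lerDl.
rewrite leNgt; apply/negP => lt.
have : vge P (P z1 + 1) (z1 + z2 - z2).
  by apply: vgeD; rewrite ?vgeN // vgeE // lezD1.
by rewrite addrK vgeE // gerDl ler10.
Qed.

Lemma value_at_unique z a b : value_at P z a -> value_at P z b -> a = b.
Proof.
case/andP=> _ ha /andP[_ hb]; apply/eqP; rewrite -subr_eq0; apply/negPn/negP => nz.
have : vge P 1 (iota (a - b)).
  rewrite rmorphB (_ : _ - _ = (z - iota b) - (z - iota a)); first by rewrite vgeD ?vgeN.
  by rewrite opprB [RHS]addrC addrA subrK.
by rewrite vgeE ?fmorph_eq0 // pval_const.
Qed.

End PlaceTheory.

Lemma eq_place (K : finFieldType) (F : fieldType) (iota : {rmorphism K -> F}) (P Q : place iota) :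
  P =1 Q -> P = Q.
Proof.
case: P Q => [v v0 vM vD vc vs] [w w0 wM wD wc ws] /= /funext E; subst w.
by congr Place; apply: Prop_irrelevance.
Qed.

(** * Places built from order functions on K[X][Y] *)

Section PlaceOfOrder.

Variables (K : finFieldType) (F : fieldType) (iota : {rmorphism K -> F}).
Variables (x y : F) (o : {poly {poly K}} -> int).
Local Notation ev := (eval2 iota x y).
Hypothesis ev_frac : forall z, exists f h, ev h != 0 /\ z = ev f / ev h.
Hypothesis oE : forall f h, ev f != 0 -> ev f = ev h -> o f = o h.
Hypothesis oM : forall f h, ev f != 0 -> ev h != 0 -> o (f * h) = o f + o h.
Hypothesis oD : forall f h, ev f != 0 -> ev h != 0 -> ev (f + h) != 0 ->
  Num.min (o f) (o h) <= o (f + h).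
Hypothesis oC : forall a, a != 0 -> exists2 c, ev c = iota a & o c = 0.
Hypothesis oS : exists f h, [/\ ev f != 0, ev h != 0 & o f = o h + 1].

Let num z := projT1 (cid (ev_frac z)).
Let den z := projT1 (cid (projT2 (cid (ev_frac z)))).

Let denP z : ev (den z) != 0 /\ z = ev (num z) / ev (den z).
Proof. exact: projT2 (cid (projT2 (cid (ev_frac z)))). Qed.

Let val z := if z == 0 then 0 else o (num z) - o (den z).

Let valE f h : ev f != 0 -> ev h != 0 -> val (ev f / ev h) = o f - o h.
Proof.
move=> fnz hnz; rewrite /val mulf_eq0 invr_eq0 (negPf fnz) (negPf hnz) /=.
have [dnz] := denP (ev f / ev h); move: (num _) (den _) dnz => f' h' dnz E.
have nnz : ev f' != 0.
  by apply: contraNneq fnz => z; move/eqP: E; rewrite z mul0r mulf_eq0 invr_eq0 (negPf hnz) orbF.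
have : o (f * h') = o (f' * h).
  apply: oE; rewrite !rmorphM ?mulf_neq0 //=.
  by rewrite -[ev f](divfK hnz) E mulrAC divfK // mulrC.
by rewrite !oM //; lia.
Qed.

(** An order on polynomials that depends only on their values in F extends to quotients. It serves
    for the weighted degree at infinity and for the order of vanishing at a finite point; [oS]
    normalizes the valuation. *)
Lemma place_of_order : exists P : place iota, forall f h, ev f != 0 -> ev h != 0 ->
  P (ev f / ev h) = o f - o h.
Proof.
have fracP z : z != 0 -> exists f h, [/\ ev f != 0, ev h != 0 & z = ev f / ev h].
  move=> nz; have [f [h [hnz E]]] := ev_frac z; exists f, h; split=> //.
  by apply: contraNneq nz => f0; rewrite E f0 mul0r.
have val0 : val 0 = 0 by rewrite /val eqxx.
have valM z t : z != 0 -> t != 0 -> val (z * t) = val z + val t.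
  move=> /fracP[f [h [fnz hnz ->]]] /fracP[f' [h' [fnz' hnz' ->]]].
  rewrite mulf_div -!rmorphM !valE ?rmorphM ?mulf_neq0 // !oM //; lia.
have valD z t : z != 0 -> t != 0 -> z + t != 0 -> Num.min (val z) (val t) <= val (z + t).
  move=> /fracP[f [h [fnz hnz ->]]] /fracP[f' [h' [fnz' hnz' ->]]].
  rewrite addf_div // -!rmorphM -rmorphD mulf_eq0 => /norP[nz _].
  have nz1 : ev (f * h') != 0 by rewrite rmorphM mulf_neq0.
  have nz2 : ev (f' * h) != 0 by rewrite rmorphM mulf_neq0.
  have := oD nz1 nz2 nz; rewrite !valE ?[ev (_ * _)]rmorphM ?mulf_neq0 //.
  rewrite (oM fnz hnz') (oM fnz' hnz) (oM hnz hnz') !ge_min.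
  by move=> /orP[le|le]; apply/orP; [left|right]; rewrite lerBrDr (le_trans _ le) //; lia.
have valC (a : K) : a != 0 -> val (iota a) = 0.
  move=> /[dup] nz /oC[c cE c0]; have [c1 c1E c10] := oC (oner_neq0 K).
  rewrite -cE -[ev c]divr1 -(rmorph1 iota) -c1E valE ?cE ?c1E ?fmorph_eq0 ?oner_neq0 //.
  by rewrite c0 c10.
have valS : exists2 t, t != 0 & val t = 1.
  have [f [h [fnz hnz E]]] := oS; exists (ev f / ev h).
    by rewrite mulf_neq0 ?invr_neq0.
  by rewrite valE // E; lia.
by exists (Place val0 valM valD valC valS).
Qed.

End PlaceOfOrder.

(** * The place at infinity *)

Section CurvePlaces.

Variables (K : finFieldType) (g : {poly K}) (e : nat).
Local Notation q := #|K|.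
Local Notation curve := (curve g).
Local Notation wdeg := (wdeg g e).
Local Notation wle := (wle e).
Hypotheses (g_monic : g \is monic) (size_g : size g = e.+1) (e_gt0 : (0 < e)%N).
Hypothesis co_qe : coprime q e.
Variables (F : fieldType) (iota : {rmorphism K -> F}) (x y : F).
Hypothesis curve_field : is_curve_field g iota x y.
Local Notation ev := (eval2 iota x y).

Let q_gt1 : (1 < q)%N := finNzRing_gt1 K.

Lemma ev_curve : ev curve = 0. Proof. by case: curve_field. Qed.

Lemma ev_rmodp f : ev (rmodp f curve) = ev f.
Proof.
by rewrite [in RHS](rdivp_eq (curve_monic g) f) eval2D eval2M ev_curve mulr0 add0r.
Qed.

Lemma ev_eq0 f : (ev f == 0) = (rmodp f curve == 0).
Proof.
rewrite -ev_rmodp; apply/eqP/eqP => [|->]; last by rewrite eval2_0.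
by case: curve_field => _ _; apply; exact: size_rmodp_curve.
Qed.

Lemma ev_eqP f h : ev f = ev h -> exists c, f = h + c * curve.
Proof.
move=> E; exists (rdivp (f - h) curve).
have := rdivp_eq (curve_monic g) (f - h).
have /eqP -> : rmodp (f - h) curve == 0 by rewrite -ev_eq0 eval2B E subrr.
by rewrite addr0 => <-; rewrite addrC subrK.
Qed.

Lemma ev_C (p : {poly K}) : ev p%:P = eval1 iota x p. Proof. exact: eval2C. Qed.

Lemma rmodp_polyC (p : {poly K}) : rmodp p%:P curve = p%:P.
Proof.
rewrite rmodp_small // size_curve // (leq_ltn_trans (size_polyC_leq1 _)) //.
by rewrite ltnS ltnW.
Qed.

Lemma evC_eq0 (p : {poly K}) : (ev p%:P == 0) = (p == 0).
Proof. by rewrite ev_eq0 rmodp_polyC polyC_eq0. Qed.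

Lemma ev_frac z : exists f h, ev h != 0 /\ z = ev f / ev h.
Proof.
have [_ /(_ z)[f [B [_ B_nz ->]]] _] := curve_field.
by exists f, B%:P; rewrite evC_eq0 B_nz ev_C.
Qed.

Lemma wdegM f h : ev f != 0 -> ev h != 0 -> wdeg (f * h) = (wdeg f + wdeg h)%N.
Proof. by rewrite !ev_eq0 => fnz hnz; have [] := rmodp_curveM g_monic size_g e_gt0 co_qe fnz hnz. Qed.

Let wle_wdeg f : wle (wdeg f) (rmodp f curve).
Proof. exact: wle_wdeg. Qed.

Lemma wdegD f h : (wdeg (f + h) <= maxn (wdeg f) (wdeg h))%N.
Proof.
have -> : wdeg (f + h) = wdeg (rmodp f curve + rmodp h curve).
  by rewrite -rmodpD ?curve_monic // wdeg_rmodp.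
apply: (wdeg_le g_monic size_g e_gt0 co_qe); apply: wleD.
  by apply: wle_mono (@wle_wdeg f); exact: leq_maxl.
by apply: wle_mono (@wle_wdeg h); exact: leq_maxr.
Qed.

Lemma wdeg_eq f h : ev f = ev h -> wdeg f = wdeg h.
Proof.
move=> /ev_eqP[c ->]; rewrite -wdeg_rmodp rmodpD ?curve_monic // rmodp_mull ?curve_monic //.
by rewrite addr0 wdeg_rmodp.
Qed.

Lemma wdegC (c : K) : wdeg c%:P%:P = 0%N.
Proof.
rewrite /wdeg rmodp_polyC /lead_form eval2C eval1C.
by have := size_polyC_leq1 c; case: size => // -[].
Qed.

Lemma wdegX : wdeg 'X%:P = q.
Proof. by rewrite /wdeg rmodp_polyC /lead_form eval2C eval1X size_polyXn. Qed.

Lemma wdegY : wdeg 'X = e.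
Proof.
rewrite /wdeg rmodp_small; last by rewrite size_polyX size_curve.
by rewrite /lead_form eval2X size_polyXn.
Qed.

Let evX_neq0 : ev 'X%:P != 0. Proof. by rewrite evC_eq0 polyX_eq0. Qed.

Let evY_neq0 : ev 'X != 0.
Proof. by rewrite ev_eq0 rmodp_small ?polyX_eq0 // size_polyX size_curve. Qed.

Lemma wdegXn f n : ev f != 0 -> wdeg (f ^+ n) = (wdeg f * n)%N.
Proof.
move=> nz; elim: n => [|n IH]; first by rewrite expr0 -polyC1 wdegC muln0.
by rewrite exprS wdegM ?eval2Xn ?expf_neq0 // IH mulnS.
Qed.

Lemma infinite_place : exists P : place iota, forall f, ev f != 0 -> P (ev f) = - (wdeg f)%:Z.
Proof.
have [| | | | |P HP] := @place_of_order K F iota x y (fun f => - (wdeg f)%:Z) ev_frac.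
- by move=> f h _ /wdeg_eq ->.
- by move=> f h fnz hnz; rewrite wdegM // PoszD opprD.
- by move=> f h _ _ _; rewrite ge_min !lerN2 !lez_nat -leq_max wdegD.
- by move=> a _; exists a%:P%:P; [rewrite /= eval2C eval1C | rewrite wdegC].
(* Bezout in the form u q = v e + 1: the function y^v / x^u is a uniformizer at infinity. *)
- have [u v E _] := @egcdnP q e (ltnW q_gt1); rewrite (eqP co_qe) in E.
  exists ('X ^+ v), ('X%:P ^+ u); rewrite !eval2Xn !expf_neq0 //; split=> //.
  by rewrite !wdegXn // wdegX wdegY; lia.
exists P => f nz; have one_nz : ev 1 != 0 by rewrite eval2_1 oner_neq0.
have := HP f 1 nz one_nz; rewrite eval2_1 divr1 => ->.
by rewrite -polyC1 wdegC oppr0 subr0.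
Qed.

End CurvePlaces.

(** * Places at finite distance *)

Section OrderAtZero.

Variable L : fieldType.
Implicit Types p u : {poly L}.

Definition order0 p (a : nat) := exists2 u, p = u * 'X^a & u.[0] != 0.

Lemma order0_exists p : p != 0 -> exists a, order0 p a.
Proof.
move=> nz; have [a [u]] := multiplicity_XsubC p 0; rewrite nz subr0 /= => u0 E.
by exists a, u.
Qed.

Lemma order0_unique p a b : order0 p a -> order0 p b -> a = b.
Proof.
wlog ab : a b / (a <= b)%N => [hw ha hb|[u E u0] [v E' v0]].
  by case/orP: (leq_total a b) => h; [exact: hw | apply/esym/hw].
move: E'; rewrite {}E -(subnK ab) exprD mulrA => /(mulIf (monic_neq0 (monicXn _ _))) E.
move: u0; rewrite E hornerM hornerXn expr0n.
by case: (b - a)%N (subnK ab) => [|n]; rewrite ?mulr0 ?eqxx // add0n.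
Qed.

Lemma order0M p u a b : order0 p a -> order0 u b -> order0 (p * u) (a + b).
Proof.
move=> [p' -> p0] [u' -> u0]; exists (p' * u'); last by rewrite hornerM mulf_neq0.
by rewrite exprD mulrACA.
Qed.

Lemma order0_neq0 p a : order0 p a -> p != 0.
Proof.
move=> [u -> u0]; apply: mulf_neq0; last by rewrite monic_neq0 ?monicXn.
by apply: contraNneq u0 => ->; rewrite horner0.
Qed.

Lemma order0_modX p u a n : (a < n)%N -> order0 p a -> order0 (p + u * 'X^n) a.
Proof.
move=> an [p' -> p0]; exists (p' + u * 'X^(n - a)).
  by rewrite mulrDl -mulrA -exprD subnK // ltnW.
by rewrite hornerD hornerM hornerXn expr0n subn_eq0 leqNgt an mulr0 addr0.
Qed.

Lemma order0D p u a b c : order0 p a -> order0 u b -> order0 (p + u) c ->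
  (minn a b <= c)%N.
Proof.
wlog ab : a b p u / (a <= b)%N => [hw ha hb hc|].
  case/orP: (leq_total a b) => h; first exact: hw hc.
  by rewrite minnC; apply: (hw _ _ u p) => //; rewrite addrC.
move=> [p' -> p0] [u' -> u0] [w E w0]; rewrite (minn_idPl ab) leqNgt; apply/negP => ca.
have [k bE] : exists k, b = (k + a)%N by exists (b - a)%N; rewrite subnK.
have [l aE] : exists l, a = (l.+1 + c)%N by exists (a - c.+1)%N; lia.
move: E; rewrite bE exprD mulrA -mulrDl aE exprD mulrA => /(mulIf (monic_neq0 (monicXn _ _))) E.
by move: w0; rewrite -E hornerM hornerXn exprS mul0r mulr0 eqxx.
Qed.

Lemma order0_Xn p n a : order0 (p * 'X^n) a -> (n <= a)%N.
Proof.
move=> [u E u0]; rewrite leqNgt; apply/negP => an; move: E.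
rewrite -(subnK an) addnS -addSn exprD mulrA => /(mulIf (monic_neq0 (monicXn _ _))) E.
by move: u0; rewrite -E hornerM hornerXn exprS mul0r mulr0 eqxx.
Qed.

Lemma order0_gt0 p a : order0 p a -> (p.[0] == 0) = (0 < a)%N.
Proof.
move=> [u -> u0]; rewrite hornerM hornerXn; case: a => [|a]; last by rewrite exprS mul0r mulr0 eqxx.
by rewrite expr0 mulr1 (negPf u0).
Qed.

End OrderAtZero.

Section FinitePlace.

Variables (K : finFieldType) (g : {poly K}).
Local Notation q := #|K|.
Local Notation curve := (curve g).
Variables (F : fieldType) (iota : {rmorphism K -> F}) (x y : F).
Hypothesis curve_field : is_curve_field g iota x y.
Local Notation ev := (eval2 iota x y).
Variables (L : fieldType) (j : {rmorphism K -> L}) (alpha beta : L) (m : nat).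
Hypotheses (on_curve : eval2 j alpha beta curve = 0).
Hypotheses (m_gt0 : (0 < m)%N) (alpha_Frob : alpha ^+ (q ^ m) = alpha).

Let q_gt1 : (1 < q)%N := finNzRing_gt1 K.

Let jP : {rmorphism K -> {poly L}} := polyC \o j.
Let shift : {poly L} := 'X + alpha%:P.
Let defect : {poly L} := eval1 jP shift g - (eval1 j alpha g)%:P.
Let branch n : {poly L} := beta%:P - \sum_(i < n) defect ^+ (q ^ i).

(* Truncations of the expansion at (alpha, beta) in t = x - alpha: the Artin-Schreier equation for y
   is solved by y = beta - sum_i defect^(q^i). *)
Local Notation expansion n := (eval2 jP shift (branch n)).

Let eval1_at0 p : (eval1 jP shift p).[0] = eval1 j alpha p.
Proof.
rewrite -[LHS]/(horner_eval 0 (eval1 jP shift p)).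
rewrite (eval1_comp (k := j)) => [|c]; last exact: hornerC.
by rewrite /= /horner_eval /shift hornerD hornerX hornerC add0r.
Qed.

Let defectX : exists d, defect = d * 'X.
Proof.
have : root defect 0 by rewrite rootE hornerD hornerN hornerC eval1_at0 subrr.
by move=> /factor_theorem[d E]; exists d; rewrite E subr0.
Qed.

Let branch_at0 n : (branch n).[0] = beta.
Proof.
have [d dE] := defectX.
rewrite hornerD hornerC hornerN horner_sum big1 ?subr0 // => i _.
by rewrite dE horner_exp hornerM hornerX mulr0 expr0n expn_eq0 -leqn0 leqNgt ltnW.
Qed.

Let expansion_at0 n f : (expansion n f).[0] = eval2 j alpha beta f.
Proof.
rewrite -[LHS]/(horner_eval 0 (eval2 jP shift (branch n) f)).
rewrite (eval2_comp (k := j)) => [|c]; last exact: hornerC.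
by rewrite /= /horner_eval branch_at0 /shift hornerD hornerX hornerC add0r.
Qed.

Let defectXn n : exists d, defect ^+ (q ^ n) = d * 'X^(q ^ n).
Proof. by have [d ->] := defectX; exists (d ^+ (q ^ n)); rewrite exprMn. Qed.

(** The sum in [branch] telescopes under Frobenius. Only -defect^(q^n) survives, and t^(q^n) divides
    it because [defect] vanishes at 0. *)
Let expansion_curve n : exists d, expansion n curve = d * 'X^(q ^ n).
Proof.
have [d dE] := defectXn n; exists (- d).
have Eg : beta ^+ q - beta = eval1 j alpha g.
  apply/eqP; rewrite -subr_eq0; apply/eqP; rewrite -on_curve /curve.
  by rewrite !eval2B eval2Xn eval2X eval2C.
rewrite mulNr -dE /curve !eval2B eval2Xn eval2X eval2C.
have -> : eval1 jP shift g = defect + (eval1 j alpha g)%:P by rewrite subrK.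
rewrite -Eg /branch -[X in _ ^+ X](expn1 q) (FrobB jP) (Frob_sum jP) expn1.
under eq_bigr => i _ do rewrite -exprM mulnC -expnS.
rewrite polyCB polyC_exp -[in LHS](big_mkord xpredT (fun i => defect ^+ (q ^ i.+1))).
rewrite -[\sum_(i < n) defect ^+ _](big_mkord xpredT (fun i => defect ^+ (q ^ i))).
have : \sum_(0 <= i < n) defect ^+ (q ^ i) + defect ^+ (q ^ n) =
       defect + \sum_(0 <= i < n) defect ^+ (q ^ i.+1).
  by rewrite -big_nat_recr //= big_nat_recl // expr1.
move: (\sum_(0 <= i < n) _) (\sum_(0 <= i < n) _) => S' S E.
have -> : defect ^+ (q ^ n) = defect + S' - S by rewrite -E addrAC subrr add0r.
by ring.
Qed.

Let expansion_step n f : exists c, expansion n.+1 f = expansion n f + c * 'X^(q ^ n).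
Proof.
have [d dE] := defectXn n.
have stepE : branch n.+1 = branch n - defect ^+ (q ^ n).
  by rewrite /branch big_ord_recr /= opprD addrA.
set p := map_poly (eval1 jP shift) f.
have : root (p - p.[branch n]%:P) (branch n) by rewrite rootE !hornerE subrr.
move=> /factor_theorem[r rE]; exists (- r.[branch n.+1] * d).
have : (p - p.[branch n]%:P).[branch n.+1] = r.[branch n.+1] * - defect ^+ (q ^ n).
  by rewrite rE hornerM hornerXsubC stepE [branch n - _]addrC addrK.
rewrite hornerD hornerN hornerC => /eqP; rewrite subr_eq => /eqP E.
by rewrite !eval2E -/p E addrC dE mulrN mulNr mulNr mulrA.
Qed.

Let expn_lt n : (n < q ^ n)%N. Proof. exact: ltn_expl. Qed.

Let expansion_mod n k f : (n <= k)%N ->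
  exists c, expansion k f = expansion n f + c * 'X^(q ^ n).
Proof.
move=> /subnK <-; elim: (k - n)%N => [|l [c cE]].
  by exists 0; rewrite mul0r addr0.
have [d dE] := expansion_step (l + n) f.
exists (c + d * 'X^(q ^ (l + n) - q ^ n)); rewrite addSn dE cE mulrDl -addrA.
by rewrite -[_ * _ * 'X^_]mulrA -exprD subnK // leq_exp2l // leq_addl.
Qed.

(* All sufficiently long truncations have the same order of vanishing. *)
Definition expansion_order f a := exists n0, forall n, (n0 <= n)%N -> order0 (expansion n f) a.

(** The n-th truncation is exact modulo t^(q^n), so an order found below that precision is final. *)
Let expansion_order_start n f a : (a < q ^ n)%N -> order0 (expansion n f) a -> expansion_order f a.
Proof.
move=> an h; exists n => k nk; have [c ->] := expansion_mod f nk.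
exact: order0_modX.
Qed.

Let expansion_order_unique f a b : expansion_order f a -> expansion_order f b -> a = b.
Proof.
move=> [n na] [k kb]; apply: order0_unique (na (maxn n k) _) (kb (maxn n k) _).
  exact: leq_maxl.
exact: leq_maxr.
Qed.

Let expansion_orderM f h a b : expansion_order f a -> expansion_order h b -> expansion_order (f * h) (a + b).
Proof.
move=> [n na] [k kb]; exists (maxn n k) => l; rewrite geq_max => /andP[nl kl].
by rewrite eval2M; apply: order0M; [exact: na | exact: kb].
Qed.

Let expansion_orderD f h a b c : expansion_order f a -> expansion_order h b -> expansion_order (f + h) c -> (minn a b <= c)%N.
Proof.
move=> [n na] [k kb] [l lc]; pose N := maxn n (maxn k l).
apply: (order0D (na N _) (kb N _)); rewrite ?leq_max ?leqnn ?orbT //.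
by rewrite -eval2D; apply: lc; rewrite !leq_max leqnn !orbT.
Qed.

Let expansion_order_ev f h a : ev f = ev h -> expansion_order f a -> expansion_order h a.
Proof.
move=> /esym E [n0 na]; have [c ->] := ev_eqP curve_field E.
pose n := maxn n0 a; apply: (@expansion_order_start n).
  by rewrite (leq_trans (expn_lt _)) // leq_exp2l // leq_maxr.
rewrite eval2D eval2M; have [d ->] := expansion_curve n; rewrite mulrA.
apply: order0_modX; last by apply: na; rewrite leq_maxl.
by rewrite (leq_trans (expn_lt _)) // leq_exp2l // leq_maxr.
Qed.

Let expansionC n (p : {poly K}) : expansion n p%:P = eval1 jP shift p.
Proof. exact: eval2C. Qed.

Let eval1_shift p : eval1 jP shift p = map_poly j p \Po shift.
Proof.
rewrite eval1_sum comp_polyE size_map_poly; apply: eq_bigr => i _.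
by rewrite coef_map /= mul_polyC.
Qed.

(** Writing the inverse of f as h / B(x) gives f h = B(x) in F. The polynomial B(t + alpha) has a
    finite order b, and the b-th truncation has precision q^b > b, so f has order at most b
    there. *)
Let expansion_order_exists f : ev f != 0 -> exists a, expansion_order f a.
Proof.
move=> nz; have [_ /(_ (ev f)^-1)[h [B [_ B_nz E]]] _] := curve_field.
have Eev : ev (f * h) = ev B%:P.
  rewrite eval2M; apply: (mulfI (invr_neq0 nz)); rewrite mulKf // {}E eval2C.
  by rewrite divfK // -(@eval2C _ _ iota x y) (evC_eq0 curve_field).
have [c cE] := ev_eqP curve_field Eev.
have B'_nz : eval1 jP shift B != 0.
  rewrite eval1_shift -size_poly_eq0 size_comp_poly2 ?size_XaddC //.
  by rewrite size_map_poly size_poly_eq0.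
have [b ob] := order0_exists B'_nz.
have ofh : order0 (expansion b f * expansion b h) b.
  rewrite -eval2M cE eval2D eval2M expansionC.
  by have [d ->] := expansion_curve b; rewrite mulrA; apply: order0_modX.
have := order0_neq0 ofh; rewrite mulf_eq0 => /norP[/order0_exists[a oa] /order0_exists[a' oa']].
exists a; apply: (expansion_order_start _ oa); rewrite (leq_trans _ (expn_lt b)) // ltnS.
by rewrite -(order0_unique (order0M oa oa') ofh) leq_addr.
Qed.

Let order_ex f : exists a, ev f != 0 -> expansion_order f a.
Proof.
have [_|nz] := eqVneq (ev f) 0; first by exists 0%N.
by have [a oa] := expansion_order_exists nz; exists a.
Qed.

Let order f : nat := projT1 (cid (order_ex f)).

Let orderP f : ev f != 0 -> expansion_order f (order f).
Proof. exact: projT2 (cid (order_ex f)). Qed.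

Let order_eq f a : ev f != 0 -> expansion_order f a -> order f = a.
Proof. by move=> /orderP; apply: expansion_order_unique. Qed.

Let expansion_order_gt0 f a : expansion_order f a -> (eval2 j alpha beta f == 0) = (0 < a)%N.
Proof. by move=> [n /(_ n (leqnn n))]; rewrite -(expansion_at0 n) => /order0_gt0. Qed.

Let expansion_order_const (a : K) : a != 0 -> expansion_order a%:P%:P 0.
Proof.
move=> nz; apply: (@expansion_order_start 0); first by rewrite expn0.
rewrite expansionC eval1C; exists (j a)%:P; first (rewrite expr0 mulr1; exact: erefl).
by rewrite hornerC fmorph_eq0.
Qed.

(** X - alpha need not have coefficients in K, but X^(q^m) - X does. By [alpha_Frob] it turns into
    t^(q^m) - t, which has a simple zero at t = 0. This is why alpha is required to be fixed by a
    power of Frobenius. *)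
Let expansion_order_uniformizer : expansion_order ('X ^+ (q ^ m) - 'X)%:P 1.
Proof.
apply: (@expansion_order_start 1); first by rewrite expn1.
rewrite expansionC eval1B eval1Xn eval1X /shift (FrobD jP) -polyC_exp alpha_Frob.
have qm_gt1 : (1 < q ^ m)%N by rewrite -(expn0 q) ltn_exp2l.
exists ('X ^+ (q ^ m).-1 - 1).
  by rewrite mulrBl -exprSr prednK ?mul1r ?(ltnW qm_gt1) // opprD addrACA subrr addr0.
rewrite hornerD hornerN hornerXn hornerC expr0n.
by case: (q ^ m)%N qm_gt1 => [|[|n]] // _; rewrite sub0r oppr_eq0 oner_neq0.
Qed.

(** The residue c lives in L, whereas only constants from K can be subtracted inside F; hence the
    detour through c' in the last clause. For L = K it says that the residue field is K. *)
Lemma finite_place : exists P : place iota,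
  [/\ forall f, vge P 0 (ev f),
      forall f, vge P 1 (ev f) <-> eval2 j alpha beta f = 0 &
      forall z, vge P 0 z -> exists c : L, forall c', j c' = c -> vge P 1 (z - iota c')].
Proof.
have [| | | | |P HP] := @place_of_order K F iota x y (fun f => (order f)%:Z)
    (ev_frac curve_field).
- move=> f h nz E; have hnz : ev h != 0 by rewrite -E.
  by congr Posz; apply: order_eq => //; apply: expansion_order_ev (orderP hnz).
- move=> f h nz hnz; rewrite -PoszD; congr Posz; apply: order_eq.
    by rewrite eval2M mulf_neq0.
  by apply: expansion_orderM; apply: orderP.
- move=> f h nz hnz nz'; have := expansion_orderD (orderP nz) (orderP hnz) (orderP nz').
  by rewrite geq_min ge_min !lez_nat.
- move=> a nz; exists a%:P%:P; rewrite /= ?eval2C ?eval1C //.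
  by rewrite (order_eq _ (expansion_order_const nz)) // eval2C eval1C fmorph_eq0.
- exists ('X ^+ (q ^ m) - 'X)%:P, 1.
  have nz : ev ('X ^+ (q ^ m) - 'X)%:P != 0.
    rewrite (evC_eq0 curve_field) subr_eq0; apply/eqP => /(congr1 (fun p : {poly K} => size p))/eqP.
    have : (1 < q ^ m)%N by rewrite -(expn0 q) ltn_exp2l.
    by rewrite size_polyXn size_polyX eqSS; case: (q ^ m)%N => [|[]].
  have nz1 : ev 1 != 0 by rewrite eval2_1 oner_neq0.
  split=> //; rewrite (order_eq nz expansion_order_uniformizer).
  by rewrite (order_eq nz1 (expansion_order_const (oner_neq0 _))).
have nz1 : ev 1 != 0 by rewrite eval2_1 oner_neq0.
have evE f : ev f != 0 -> P (ev f) = order f.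
  move=> nz; rewrite -[ev f]divr1 -(eval2_1 iota x y) HP //.
  by rewrite (order_eq nz1 (expansion_order_const (oner_neq0 _))) subr0.
have vge1 f : vge P 1 (ev f) <-> eval2 j alpha beta f = 0.
  rewrite /vge; case: eqP => [f0|/eqP nz] /=.
    split=> // _; have /esym := f0; rewrite -(eval2_0 iota x y) => /(ev_eqP curve_field)[c].
    move=> /(congr1 (eval2 j alpha beta)); rewrite eval2_0 eval2D eval2M.
    by rewrite on_curve mulr0 addr0.
  rewrite evE // lez_nat -(expansion_order_gt0 (orderP nz)).
  by split=> [/eqP|->].
exists P; split=> // [f|z Pz].
  by have [->|nz] := eqVneq (ev f) 0; rewrite ?vge0 // vgeE // evE.
have [z0|nz] := eqVneq z 0.
  exists 0 => c' /eqP; rewrite fmorph_eq0 => /eqP ->.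
  by rewrite z0 rmorph0 subrr vge0.
have [f [h [hnz zE]]] := ev_frac curve_field z.
have fnz : ev f != 0 by apply: contraNneq nz => f0; rewrite zE f0 mul0r.
rewrite vgeE // zE HP // subr_ge0 lez_nat in Pz.
have [n1 of_] := orderP fnz; have [n2 oh] := orderP hnz.
pose n := maxn (maxn n1 n2) (order h).
have [u uE u0] := of_ n (leq_trans (leq_maxl _ _) (leq_maxl _ _)).
have [v vE v0] := oh n (leq_trans (leq_maxr _ _) (leq_maxl _ _)).
have [w wE] : exists w, u * 'X^(order f - order h) = w by eexists.
(* The residue of f / h: divide both expansions by t^(order h) and take the quotient of their values
   at 0. Subtracting c' h from f then raises the order above that of h. *)
exists (w.[0] / v.[0]) => c' c'E.
have [Ez|nz'] := eqVneq (z - iota c') 0; first by rewrite Ez vge0.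
pose f' := f - c'%:P%:P * h.
have f'E : ev f' = ev h * (z - iota c').
  by rewrite /f' eval2B eval2M eval2C eval1C mulrBr zE mulrCA divff // mulr1 mulrC.
have f'nz : ev f' != 0 by rewrite f'E mulf_neq0.
have -> : z - iota c' = ev f' / ev h by rewrite f'E mulrAC divff ?mul1r.
rewrite vgeE ?mulf_neq0 ?invr_neq0 // HP //.
suff : (order h < order f')%N by lia.
rewrite ltnNge; apply/negP => le.
have [n3 /(_ (maxn n n3) (leq_maxr _ _))] := orderP f'nz.
have [d ->] := expansion_mod f' (leq_maxl n n3).
have h_lt : (order h < q ^ n)%N by rewrite (leq_ltn_trans _ (expn_lt n)) // leq_maxr.
have : root (w - (j c')%:P * v) 0.
  by rewrite rootE hornerD hornerN hornerM hornerC c'E divfK // subrr.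
move=> /factor_theorem[r]; rewrite subr0 => rE.
have uE' : expansion n f = w * 'X^(order h) by rewrite uE -wE -mulrA -exprD subnK.
have nE : expansion n f' = r * 'X^((order h).+1).
  by rewrite /f' eval2B eval2M expansionC eval1C uE' vE exprS mulrA -rE mulrBl mulrA.
rewrite nE (_ : d * 'X^(q ^ n) = d * 'X^(q ^ n - (order h).+1) * 'X^((order h).+1)).
  by rewrite -mulrDl => /order0_Xn; rewrite ltnNge le.
by rewrite -mulrA -exprD subnK.
Qed.

End FinitePlace.

(** * Riemann-Roch spaces of the place at infinity *)

(** Pigeonhole: the powers X^(q^k) have finitely many remainders modulo a monic annihilator of z, so
    z^(q^a) = z^(q^b) for some a < b, and the q^a-th power map is injective. *)
Lemma algebraic_Frob (K : finFieldType) (E : fieldType) (i : {rmorphism K -> E}) (z : E) :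
  algebraicOver i z -> exists2 m, (0 < m)%N & z ^+ (#|K| ^ m) = z.
Proof.
move=> /integral_algebraic[p p_monic pz].
pose d := (size p).-1.
pose r k : 'rV[K]_d := poly_rV (rmodp 'X^(#|K| ^ k) p).
have size_r k : (size (rmodp 'X^(#|K| ^ k) p) <= d)%N.
  rewrite /d; have := ltn_rmodpN0 'X^(#|K| ^ k) (monic_neq0 p_monic).
  by case: (size p).
have zE k : z ^+ (#|K| ^ k) = (map_poly i (rVpoly (r k))).[z].
  rewrite poly_rV_K //.
  have := rdivp_eq p_monic 'X^(#|K| ^ k) => /(congr1 (fun u => (map_poly i u).[z])).
  by rewrite map_polyXn hornerXn rmorphD rmorphM hornerD hornerM /= (rootP pz) mulr0 add0r.
pose N := #|{: 'rV[K]_d}|.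
have /injectivePn[a [b ab rab]] : ~~ injectiveb (fun k : 'I_N.+1 => r k).
  by apply/negP => /injectiveP/leq_card; rewrite card_ord ltnn.
wlog lt : a b ab rab / (a < b)%N => [hw|].
  case: (ltngtP a b) => [lt|lt|/val_inj eq]; first exact: hw lt.
    by apply: (hw b a) => //; rewrite eq_sym.
  by rewrite eq eqxx in ab.
exists (b - a)%N; first by rewrite subn_gt0.
have E0 : z ^+ (#|K| ^ a) = z ^+ (#|K| ^ b) by rewrite !zE rab.
have : (z ^+ (#|K| ^ (b - a)) - z) ^+ (#|K| ^ a) = 0.
  by rewrite (FrobB i) -exprM -expnD subnK ?(ltnW lt) // E0 subrr.
by move=> /eqP; rewrite expf_eq0 subr_eq0 => /andP[_ /eqP].
Qed.

(** D is a minimal polynomial of z over K, obtained as an annihilator of least size. *)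
Lemma vanishing_ideal (K E : fieldType) (i : {rmorphism K -> E}) (z : E) (B : {poly K}) :
  B != 0 -> root (map_poly i B) z -> exists D : {poly K}, (1 < size D)%N /\
    forall p, root (map_poly i p) z -> D %| p.
Proof.
move=> B_nz Bz.
have ex : exists n, `[< exists D : {poly K}, [/\ D != 0, root (map_poly i D) z & size D = n] >].
  by exists (size B); apply/asboolP; exists B.
case: (ex_minnP ex) => n /asboolP[D [D_nz Dz Dn]] minD.
exists D; split.
  rewrite ltnNge; apply/negP => /size1_polyC DE.
  by move: Dz D_nz; rewrite DE map_polyC /root hornerC fmorph_eq0 polyC_eq0 => ->.
move=> p pz; apply/modp_eq0P/eqP; apply/negPn/negP => nz.
have := minD (size (p %% D)); rewrite leqNgt -Dn ltn_modpN0 // => /(_ _)/notF; apply.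
apply/asboolP; exists (p %% D); split=> //.
move: pz; rewrite {1}(divp_eq p D) rmorphD rmorphM /= /root hornerD hornerM.
by rewrite (rootP Dz) mulr0 add0r.
Qed.

(** * The field of constants *)

Section ConstantField.

Variables (K : finFieldType) (F : fieldType) (iota : {rmorphism K -> F}) (P : place iota).

Lemma pval_Frob z m : (0 < m)%N -> z != 0 -> z ^+ (#|K| ^ m) = z -> P z = 0.
Proof.
move=> m_gt0 nz E; have := pvalX P (#|K| ^ m) nz; rewrite E => /eqP.
rewrite -[X in X == _]mul1r -subr_eq0 -mulrBl mulf_eq0 => /orP[|/eqP//].
have : (1 < #|K| ^ m)%N by rewrite -(expn0 #|K|) ltn_exp2l // finNzRing_gt1.
by case: (_ ^ _)%N => [|[|n]].
Qed.

(** If z is algebraic with residue c, then z - c is fixed by a power of Frobenius, so its valuation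
    is 0 unless z = c; but it is at least 1. *)
Lemma full_constant_field_residue :
  (forall z, vge P 0 z -> exists c, vge P 1 (z - iota c)) -> full_constant_field iota.
Proof.
move=> res z /[dup] /algebraic_Frob[m m_gt0 zE] alg.
have [c hc] : exists c, vge P 1 (z - iota c).
  apply: res; have [->|nz] := eqVneq z 0; first exact: vge0.
  by rewrite vgeE // (pval_Frob m_gt0).
exists c; apply/eqP; rewrite -subr_eq0; apply/negPn/negP => nz.
move: hc; rewrite vgeE // (pval_Frob m_gt0) //.
by rewrite (FrobB iota) zE (Frob_const iota).
Qed.

End ConstantField.

Section CurveRR.

Variables (K : finFieldType) (g : {poly K}) (e : nat).
Local Notation q := #|K|.
Local Notation curve := (curve g).
Local Notation wdeg := (wdeg g e).
Local Notation wle := (wle e).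
Hypotheses (g_monic : g \is monic) (size_g : size g = e.+1) (e_gt0 : (0 < e)%N).
Hypothesis co_qe : coprime q e.
Variables (F : fieldType) (iota : {rmorphism K -> F}) (x y : F).
Hypothesis curve_field : is_curve_field g iota x y.
Local Notation ev := (eval2 iota x y).
Variable Pinf : place iota.
Hypothesis PinfE : forall f, ev f != 0 -> Pinf (ev f) = - (wdeg f)%:Z.

Let q_gt1 : (1 < q)%N := finNzRing_gt1 K.

Let evX : ev 'X%:P = x. Proof. by rewrite eval2C eval1X. Qed.
Let evY : ev 'X = y. Proof. exact: eval2X. Qed.

Let x_neq0 : x != 0.
Proof. by rewrite -evX (evC_eq0 curve_field) polyX_eq0. Qed.

Let y_neq0 : y != 0.
Proof.
by rewrite -evY (ev_eq0 curve_field) rmodp_small ?polyX_eq0 // size_polyX size_curve.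
Qed.

Let xyE : y ^+ q - y = eval1 iota x g.
Proof.
have := ev_curve curve_field; rewrite /curve !eval2B eval2Xn eval2X eval2C.
by move=> /eqP; rewrite subr_eq0 => /eqP.
Qed.

Lemma curve_is_function_field : is_function_field iota.
Proof.
exists x.
  move=> /algebraic_Frob[m m_gt0 xE]; have := pval_Frob Pinf m_gt0 x_neq0 xE.
  by rewrite -evX PinfE ?evX // wdegX //; have := q_gt1; lia.
exists q, (fun k => y ^+ k) => z.
have [_ /(_ z)[f [B [fq B_nz ->]]] _] := curve_field.
exists (fun k => f`_k), (fun _ => B); split=> //.
rewrite eval2_sum mulr_suml (big_ord_widen q (fun k => eval1 iota x f`_k * y ^+ k / eval1 iota x B)) //.
rewrite big_mkcond; apply: eq_bigr => k _ /=; case: ltnP => [_|fk]; first by rewrite mulrAC.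
by rewrite (nth_default _ fk) rmorph0 horner0 !mul0r.
Qed.

Let evE f : ev f = \sum_(j < size f) \sum_(i < size f`_j) iota f`_j`_i * (x ^+ i * y ^+ j).
Proof.
rewrite eval2_sum; apply: eq_bigr => j _; rewrite eval1_sum mulr_suml.
by apply: eq_bigr => i _; rewrite mulrA.
Qed.

Section Place.

Variable P : place iota.

(** At a pole of y the term y^q would dominate y and give y^q - y = g(x) a pole. *)
Lemma vge_y : vge P 0 x -> vge P 0 y.
Proof.
move=> Px; have Pg : vge P 0 (y ^+ q - y).
  rewrite xyE eval1_sum; apply: vge_sum => i _.
  rewrite -[0]addr0; apply: vgeM; first exact: vge_const.
  rewrite vgeE ?expf_neq0 // pvalX // mulr_ge0 //.
  by rewrite -(vgeE P 0 x_neq0).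
rewrite vgeE // leNgt; apply/negP => Py.
have [||nz E] := @pval_dominant _ _ _ P (y ^+ q) (- y); first by rewrite expf_neq0.
  by rewrite vgeN vgeE // pvalX //; have := q_gt1; nia.
by move: Pg; rewrite vgeE // E pvalX //; have := q_gt1; nia.
Qed.

Lemma vge_ev f : vge P 0 x -> vge P 0 (ev f).
Proof.
move=> /[dup] /vge_y Py Px; rewrite evE; apply: vge_sum => j _; apply: vge_sum => i _.
rewrite -[0]addr0; apply: vgeM; first exact: vge_const.
move: Px Py; rewrite !vgeE ?mulf_neq0 ?expf_neq0 // pvalM ?expf_neq0 // !pvalX // => Px Py.
by rewrite addr_ge0 ?mulr_ge0.
Qed.

(** At a pole of x the equation reduces to its dominant terms, q P(y) = e P(x), and coprimality
    makes q divide P(x). *)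
Lemma pole_weights : ~~ vge P 0 x -> exists c : nat,
  [/\ (0 < c)%N, P x = - (c * q)%:Z & P y = - (c * e)%:Z].
Proof.
rewrite vgeE // -ltNge => Px.
have [k kE] : exists k : nat, P x = - k%:Z by exists (absz (P x)); lia.
have k_gt0 : (0 < k)%N by lia.
have gE : P (eval1 iota x g) = - (k * e)%:Z.
  rewrite eval1_sum size_g big_ord_recr /= addrC.
  have -> : g`_e = 1 by have /monicP := g_monic; rewrite lead_coefE size_g.
  rewrite rmorph1 mul1r.
  have [||_ ->] := @pval_dominant _ _ _ P (x ^+ e) (\sum_(i < e) iota g`_i * x ^+ i).
  - by rewrite expf_neq0.
  - apply: vge_sum => i _; rewrite -[_ + 1]add0r; apply: vgeM; first exact: vge_const.
    rewrite vgeE ?expf_neq0 // !pvalX // kE.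
    have : (k * i.+1 <= k * e)%N by rewrite leq_pmul2l.
    by clear -k_gt0; lia.
  - by rewrite pvalX // kE; lia.
have Py : P y < 0.
  rewrite ltNge; apply/negP => Py.
  have : vge P 0 (y ^+ q - y).
    by rewrite vgeD ?vgeN ?vgeE ?expf_neq0 // pvalX // mulr_ge0.
  rewrite xyE vgeE ?gE; first by nia.
  by apply: contraTneq isT => z; move: gE; rewrite z pval0; nia.
have [l lE] : exists l : nat, P y = - l%:Z by exists (absz (P y)); lia.
have [||_ E] := @pval_dominant _ _ _ P (y ^+ q) (- y); first by rewrite expf_neq0.
  by rewrite vgeN vgeE // pvalX //; have := q_gt1; nia.
have qlek : (q * l = e * k)%N.
  by move: E; rewrite xyE gE pvalX // lE; lia.
have /dvdnP[c cE] : (q %| k)%N by rewrite -(Gauss_dvdr _ co_qe) -qlek dvdn_mulr.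
exists c; split; first by lia.
  by rewrite kE cE.
rewrite lE; congr (- _%:Z); apply/eqP; rewrite -(eqn_pmul2l (ltnW q_gt1)) qlek cE.
by apply/eqP; lia.
Qed.

(** By [pole_weights] the valuation P is c times that of Pinf on monomials, and on all functions
    because the monomial of top weight dominates. Surjectivity onto the integers forces c = 1. *)
Lemma pole_unique : ~~ vge P 0 x -> P = Pinf.
Proof.
move=> /pole_weights[c [c_gt0 xE yE]].
have monE i j : P (x ^+ i * y ^+ j) = - (c * (q * i + e * j))%:Z.
  by rewrite pvalM ?expf_neq0 // !pvalX // xE yE; lia.
have low w (f : {poly {poly K}}) : (forall i j, f`_j`_i != 0 -> (q * i + e * j < w)%N) ->
    vge P (- (c * w)%:Z + 1) (ev f).
  move=> fw; rewrite evE; apply: vge_sum => j _; apply: vge_sum => i _.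
  have [->|/fw ij] := eqVneq (f`_j`_i) 0; first by rewrite rmorph0 mul0r vge0.
  rewrite -[_ + 1]add0r; apply: vgeM; first exact: vge_const.
  by rewrite vgeE ?mulf_neq0 ?expf_neq0 // monE; nia.
have main (f : {poly {poly K}}) : ev f != 0 -> P (ev f) = - (c * wdeg f)%:Z.
  move=> nz; rewrite -(ev_rmodp curve_field); set r := rmodp f curve.
  have r_nz : r != 0 by rewrite -(ev_eq0 curve_field).
  have rq : (size r <= q)%N := size_rmodp_curve _ _.
  have lr_nz : lead_form e r != 0.
    by apply: contraNneq r_nz => /(lead_form_eq0 co_qe rq) ->.
  (* The remainder contains a monomial of weight exactly [wdeg f]; by [weight_inj] all its others
     are strictly lighter. *)
  have [i0 [j0 [nz0 w0]]] : exists i j, r`_j`_i != 0 /\ (q * i + e * j)%N = wdeg f.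
    move: (lr_nz); rewrite -lead_coef_eq0 lead_coefE -/(wdeg f) lead_formE coef_sum.
    move=> /eqP; apply: contra_notP => h; apply: big1 => j _.
    rewrite coef_sum; apply: big1 => i _; rewrite coefZ coefXn.
    have [->|nz'] := eqVneq (r`_j`_i) 0; first by rewrite mul0r.
    by case: eqP => [E|]; rewrite ?mulr0 //; case: h; exists i, j.
  have j0q : (j0 < q)%N.
    by rewrite ltnNge; apply: contra nz0 => qj; rewrite [r`_j0]nth_default ?coef0 // (leq_trans rq qj).
  pose m0 := (r`_j0`_i0 *: 'X^i0)%:P * 'X^j0 : {poly {poly K}}.
  have -> : r = m0 + (r - m0) by rewrite addrC subrK.
  have m0E : ev m0 = iota r`_j0`_i0 * (x ^+ i0 * y ^+ j0).
    by rewrite /m0 eval2M eval2Xn eval2C eval2X -mul_polyC eval1M eval1Xn eval1C eval1X mulrA.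
  have m0nz : ev m0 != 0 by rewrite m0E !mulf_neq0 ?expf_neq0 ?fmorph_eq0.
  have m0P : P (ev m0) = - (c * wdeg f)%:Z.
    by rewrite m0E pvalM ?mulf_neq0 ?expf_neq0 ?fmorph_eq0 // pval_const // monE w0 add0r.
  rewrite eval2D; have [//||_ -> //] := @pval_dominant _ _ _ P (ev m0) (ev (r - m0)).
  rewrite m0P; apply: low => i j.
  rewrite !coefB coef_monom2; case: ifP => [/andP[/eqP-> /eqP->]|ij0]; first by rewrite subrr eqxx.
  rewrite subr0 => nz'; have : (q * i + e * j <= wdeg f)%N by exact: wle_wdeg nz'.
  rewrite leq_eqVlt => /predU1P[E|//].
  have jq : (j < q)%N.
    by rewrite ltnNge; apply: contra nz' => qj; rewrite [r`_j]nth_default ?coef0 // (leq_trans rq qj).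
  by have [iE jE] := weight_inj co_qe jq j0q (etrans E (esym w0)); rewrite iE jE !eqxx in ij0.
have Pc z : z != 0 -> P z = c%:Z * Pinf z.
  move=> nz; have [f [h [hnz zE]]] := ev_frac curve_field z.
  have fnz : ev f != 0 by apply: contraNneq nz => f0; rewrite zE f0 mul0r.
  by rewrite zE !pvalM ?invr_neq0 // !pvalV // !PinfE // !main //; lia.
apply: eq_place => z; have [->|nz] := eqVneq z 0; first by rewrite !pval0.
have [t t_nz tE] := pval_surj P; rewrite (Pc t t_nz) in tE.
have /eqP : absz (c%:Z * Pinf t) = 1%N by rewrite tE.
rewrite abszM muln_eq1 => /andP[/eqP c1 _].
by rewrite Pc // [c]c1 mul1r.
Qed.

End Place.

Lemma pole_divisor_RR (m : nat) f : (wdeg f <= m)%N -> RR_space << m%:Z *g Pinf >> (ev f).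
Proof.
move=> fm /eqP nz P; rewrite coeffU.
have [<-|PP] := eqVneq Pinf P; first by rewrite mulr1 PinfE //; lia.
rewrite mulr0 addr0 -(vgeE P 0 nz); apply: vge_ev.
by apply: contraNT PP => /pole_unique ->.
Qed.

(** Descent on the size of the denominator B. At a root alpha of B the numerator f = z B(x) vanishes
    on the whole fibre of the curve. This fibre has q points, more than the Y-degree of f, so every
    coefficient of f vanishes at alpha, and the minimal polynomial D of alpha cancels from f and
    B. *)
Lemma regular_ev (z : F) : (forall P : place iota, vge P 0 x -> vge P 0 z) -> exists f, z = ev f.
Proof.
move=> zP; have [_ /(_ z)[f [B [fq B_nz zE]]] _] := curve_field.
have [n] := ubnP (size B); elim: n f B fq B_nz zE => // n IHn f B fq B_nz zE /ltnSE Bn.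
have [B_const|B_gt1] := leqP (size B) 1.
  move: B_nz zE; rewrite (size1_polyC B_const) polyC_eq0 eval1C => b_nz zE.
  exists ((B`_0)^-1%:P%:P * f); rewrite eval2M eval2C eval1C fmorphV mulrC.
  exact: zE.
have [L [j _]] := countable_algebraic_closure K.
have [alpha alphaP] : exists alpha, root (map_poly j B) alpha.
  by apply/closed_rootP; rewrite size_map_poly gtn_eqF.
have [m m_gt0 alphaF] : exists2 m, (0 < m)%N & alpha ^+ (q ^ m) = alpha.
  by apply: (algebraic_Frob (i := j)); exists B.
have f_zero beta : eval2 j alpha beta curve = 0 -> eval2 j alpha beta f = 0.
  move=> on_curve.
  have [P [P0 P1 _]] := finite_place curve_field on_curve m_gt0 alphaF.
  apply/P1; have evB_nz : ev B%:P != 0 by rewrite (evC_eq0 curve_field).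
  have -> : ev f = z * ev B%:P by rewrite zE eval2C divfK // -(@eval2C _ _ iota x y).
  rewrite -[1]add0r; apply: vgeM; first by apply: zP; rewrite -evX.
  by apply/P1; rewrite eval2C; exact/rootP.
pose c := eval1 j alpha g.
have [beta0 beta0P] : exists beta0, beta0 ^+ q - beta0 = c.
  have : size ('X^q - 'X - c%:P : {poly L}) != 1%N.
    rewrite -addrA -opprD size_polyDl size_polyXn ?size_polyN; first by have := q_gt1; lia.
    rewrite ltnS (leq_trans _ q_gt1) // (leq_trans (size_polyD _ _)) //.
    by rewrite size_polyX geq_max (leq_trans (size_polyC_leq1 _)).
  move=> /closed_rootP[b]; rewrite rootE !hornerE => /eqP h; exists b.
  by apply/eqP; rewrite -subr_eq0; apply/eqP.
have coef_zero k : root (map_poly j f`_k) alpha.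
  pose fa : {poly L} := map_poly (eval1 j alpha) f.
  suff fa0 : fa = 0 by rewrite rootE -[_.[_]]/(eval1 j alpha f`_k) -coef_map -/fa fa0 coef0.
  (* The fibre above alpha: the solutions of Y^q - Y = c are the translates of one of them by K. *)
  pose rs := [seq beta0 + j a | a <- enum K].
  apply: (roots_geq_poly_eq0 (rs := rs)).
  - apply/allP => b /mapP[a _ ->]; rewrite rootE; apply/eqP; apply: f_zero.
    rewrite /curve !eval2B eval2Xn eval2X eval2C.
    rewrite -[q in _ ^+ q]expn1 (FrobD j) (Frob_const j) expn1 opprD addrACA subrr addr0.
    by rewrite beta0P subrr.
  - by rewrite map_inj_uniq ?enum_uniq // => a b /addrI/fmorph_inj.
  - by rewrite size_map -cardE (leq_trans (size_poly _ _)).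
have [D [D_gt1 Ddvd]] := vanishing_ideal B_nz alphaP.
have D_nz : D != 0 by rewrite -size_poly_gt0 ltnW.
pose f' : {poly {poly K}} := \poly_(k < size f) (f`_k %/ D).
have fE : f = D%:P * f'.
  apply/polyP => k; rewrite coefCM coef_poly; case: ltnP => [_|fk].
    by rewrite mulrC divpK // Ddvd.
  by rewrite mulr0 nth_default.
have BE : B = B %/ D * D by rewrite divpK // Ddvd.
have B'_nz : B %/ D != 0 by apply: contraNneq B_nz => B0; rewrite BE B0 mul0r.
apply: (IHn f' (B %/ D)) => //.
- by rewrite (leq_trans (size_poly _ _)).
- have evD_nz : eval1 iota x D != 0 by rewrite -(@eval2C _ _ iota x y) (evC_eq0 curve_field).
  by rewrite zE fE {1}BE eval2M eval1M eval2C [eval1 _ _ _ * ev f']mulrC -mulf_div divff // mulr1.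
- by rewrite (leq_trans _ Bn) // size_divp // ltn_subrL -(subnKC D_gt1) size_poly_gt0.
Qed.

Lemma RR_pole_divisor (m : nat) z : RR_space << m%:Z *g Pinf >> z ->
  exists2 f, (wdeg f <= m)%N & z = ev f.
Proof.
move=> zRR; have [->|nz] := eqVneq z 0.
  by exists 0; rewrite ?eval2_0 // -!polyC0 wdegC.
have [f fE] : exists f, z = ev f.
  apply: regular_ev => P Px; have /eqP nz' := nz; have := zRR nz' P.
  rewrite vgeE // coeffU; case: eqP => [E|]; last by rewrite mulr0 addr0.
  move: Px; rewrite -E -evX vgeE ?evX // -evX PinfE ?evX // wdegX //.
  by have := q_gt1; lia.
exists f => //; have /eqP nz' := nz; have := zRR nz' Pinf.
by rewrite coeffU eqxx mulr1 fE PinfE -?fE //; lia.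
Qed.

Lemma vge_Pinf_x : ~~ vge Pinf 0 x.
Proof. by rewrite -evX vgeE ?evX // -evX PinfE ?evX // wdegX //; have := q_gt1; lia. Qed.

End CurveRR.

(** * Rational places at points with coordinates in K *)

Section RationalPlace.

Variables (K : finFieldType) (g : {poly K}).
Variables (F : fieldType) (iota : {rmorphism K -> F}) (x y : F).
Hypothesis curve_field : is_curve_field g iota x y.
Local Notation ev := (eval2 iota x y).

Lemma rational_place_exists (a b : K) : eval2 idfun a b (curve g) = 0 ->
  exists P : place iota,
  [/\ rational_place P, forall z, vge P 0 z -> exists c, vge P 1 (z - iota c), vge P 0 x &
      forall f, value_at P (ev f) (eval2 idfun a b f)].
Proof.
move=> on_curve; have aF : a ^+ (#|K| ^ 1) = a by rewrite expn1 expf_card.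
have [P [P0 P1 P2]] := finite_place curve_field on_curve (ltn0Sn 0) aF.
have P2' z : vge P 0 z -> exists c, vge P 1 (z - iota c).
  by move=> /P2[c hc]; exists c; apply: hc.
exists P; split=> //; last 2 first.
- by rewrite -(@eval1X _ _ iota x) -(@eval2C _ _ iota x y).
- move=> f; rewrite /value_at P0 /=.
  have -> : ev f - iota (eval2 idfun a b f) = ev (f - (eval2 idfun a b f)%:P%:P).
    by rewrite eval2B eval2C eval1C.
  by apply/P1; rewrite eval2B eval2C eval1C subrr.
exists (fun _ => 1) => [_|z Pz]; first by rewrite -(rmorph1 iota) vge_const.
have [c hc] := P2' z Pz; exists [ffun _ => c]; split.
  by rewrite big_ord1 ffunE mulr1.
move=> c'; rewrite big_ord1 mulr1 => hc'; apply/ffunP => k; rewrite ffunE ord1.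
by apply: (@value_at_unique _ _ _ P z); rewrite /value_at Pz.
Qed.

End RationalPlace.

(** * Codes on a grid *)

Lemma card_roots_lt (K : fieldType) (n : nat) (z : 'I_n -> K) (p : {poly K}) :
  injective z -> p != 0 -> (#|[set l | root p (z l)]| < size p)%N.
Proof.
move=> z_inj p_nz; rewrite cardE -(size_map z); apply: max_poly_roots => //.
  by apply/allP => c /mapP[l]; rewrite mem_enum inE => rl ->.
by rewrite map_inj_uniq ?enum_uniq.
Qed.

Section NewtonBasis.

Variables (K : finFieldType) (a b : nat -> K).

Definition newton (z : nat -> K) n : {poly K} := \prod_(l < n) ('X - (z l)%:P).

(** It has the same leading monomial as X^i Y^j but vanishes at the points (a_l, b_t) with l < i or
    t < j. This makes the monomials outside the grid invisible to the code. *)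
Definition newton2 i j : {poly {poly K}} := (newton a i)%:P * map_poly polyC (newton b j).

Lemma newtonS z n : newton z n.+1 = newton z n * ('X - (z n)%:P).
Proof. by rewrite /newton big_ord_recr. Qed.

Lemma newton_monic z n : newton z n \is monic.
Proof. exact: monic_prod_XsubC. Qed.

Lemma size_newton z n : size (newton z n) = n.+1.
Proof. by rewrite size_prod_XsubC /index_enum -enumT size_enum_ord. Qed.

Lemma newton_root z n l : (l < n)%N -> (newton z n).[z l] = 0.
Proof.
move=> ln; rewrite horner_prod (bigD1 (Ordinal ln)) //=.
by rewrite hornerXsubC subrr mul0r.
Qed.

Lemma coef_newton z n m : (n <= m)%N -> (newton z n)`_m = (n == m)%:R.
Proof.
rewrite leq_eqVlt => /predU1P[<-|nm]; last by rewrite nth_default ?size_newton // ltn_eqF.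
by have /monicP := newton_monic z n; rewrite lead_coefE size_newton eqxx.
Qed.

Local Notation evpt l t := (eval2 idfun (a l) (b t)).

Lemma eval1_id (c : K) p : eval1 idfun c p = p.[c].
Proof. by rewrite eval1E map_poly_id. Qed.

Lemma evpt_newton2 l t i j : evpt l t (newton2 i j) = (newton a i).[a l] * (newton b j).[b t].
Proof.
rewrite /newton2 eval2M eval2C eval1_id; congr (_ * _).
rewrite eval2E -map_poly_comp map_poly_id // => c _ /=.
by rewrite eval1C.
Qed.

Lemma wle_newton2 e i j : wle e (#|K| * i + e * j) (newton2 i j).
Proof.
apply: wleM => [{j}|{i}].
  move=> i' j; rewrite coefC; case: (j =P 0%N) => [->|_]; last by rewrite coef0 eqxx.
  move=> nz; rewrite muln0 addn0 leq_mul2l; apply/orP; right.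
  by rewrite -ltnS -(size_newton a i) ltnNge; apply: contra nz => /leq_sizeP ->.
move=> i j'; rewrite coef_map /= coefC; case: (i =P 0%N) => [->|_]; last by rewrite eqxx.
move=> nz; rewrite muln0 add0n leq_mul2l; apply/orP; right.
by rewrite -ltnS -(size_newton b j) ltnNge; apply: contra nz => /leq_sizeP ->.
Qed.

(** The leading term is taken lexicographically, Y-degree first, and not by weight: i2 maximizes the
    Y-degree, then i3 the X-degree. The coefficient [FJ] of the top power of Y has degree [pi i3],
    so it is nonzero for at least R - pi i3 values of l. *)
Lemma newton2_weight (R M : nat) (I : finType) (pi pj : I -> nat) (u : I -> K) :
  {in gtn R &, injective a} -> {in gtn M &, injective b} ->
  injective (fun i => (pi i, pj i)) -> (exists i, u i != 0) ->
  exists2 i, u i != 0 & ((R - pi i) * (M - pj i) <=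
    #|[set lt : 'I_R * 'I_M |
        (\sum_i u i * evpt lt.1 lt.2 (newton2 (pi i) (pj i)) != 0)%R]|)%N.
Proof.
move=> a_inj b_inj p_inj [i1 u1].
have [i2 u2 max2] := @arg_maxnP _ i1 (fun i => u i != 0) pj u1.
have [i3 /andP[u3 /eqP j3] max3] :=
  @arg_maxnP _ i2 (fun i => (u i != 0) && (pj i == pj i2)) pi (introT andP (conj u2 (eqxx _))).
exists i3 => //; set J := pj i3; set I0 := pi i3.
have J_max i : u i != 0 -> (pj i <= J)%N by rewrite /J j3; exact: max2.
pose FJ : {poly K} := \sum_(i | pj i == J) u i *: newton a (pi i).
have coefFJ : FJ`_I0 = u i3.
  rewrite coef_sum (bigD1 i3) //= coefZ coef_newton // eqxx mulr1 big1 ?addr0 // => i.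
  move=> /andP[/eqP ji i_neq]; rewrite coefZ; have [->|ui] := eqVneq (u i) 0; first by rewrite mul0r.
  have le : (pi i <= I0)%N by apply: max3; rewrite ui ji /J j3 eqxx.
  rewrite coef_newton //; case: eqP => [ei|_]; last by rewrite mulr0.
  by case/eqP: i_neq; apply: p_inj; rewrite ei ji.
have FJ_nz : FJ != 0 by apply: contraNneq u3 => F0; rewrite -coefFJ F0 coef0.
have size_FJ : (size FJ <= I0.+1)%N.
  apply: (leq_trans (size_sum _ _ _)); apply/bigmax_leqP => i /eqP ji.
  have [->|ui] := eqVneq (u i) 0; first by rewrite scale0r size_poly0.
  rewrite (leq_trans (size_scale_leq _ _)) // size_newton ltnS.
  by apply: max3; rewrite ui ji /J j3 eqxx.
pose f (l : 'I_R) : {poly K} := \sum_i (u i * (newton a (pi i)).[a l]) *: newton b (pj i).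
have size_f l : (size (f l) <= J.+1)%N.
  apply: (leq_trans (size_sum _ _ _)); apply/bigmax_leqP => i _.
  have [->|ui] := eqVneq (u i) 0; first by rewrite mul0r scale0r size_poly0.
  by rewrite (leq_trans (size_scale_leq _ _)) // size_newton ltnS J_max.
have coef_f l : (f l)`_J = FJ.[a l].
  rewrite coef_sum horner_sum [RHS]big_mkcond; apply: eq_bigr => i _; rewrite coefZ.
  have [->|ui] := eqVneq (u i) 0; first by rewrite scale0r horner0 !mul0r; case: ifP.
  by rewrite coef_newton ?J_max //; case: ifP; rewrite ?mulr1 ?mulr0 // hornerZ.
pose Z := [set l : 'I_R | root FJ (a l)].
have Z_le : (#|Z| <= I0)%N.
  rewrite -ltnS (leq_trans _ size_FJ) //; apply: card_roots_lt => // l l' E.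
  by apply: val_inj; apply: a_inj E; rewrite inE.
have row_le l : l \notin Z -> (M - J <= #|[set t : 'I_M | ((f l).[b t] != 0)%R]|)%N.
  rewrite inE rootE => nz.
  have f_nz : f l != 0 by apply: contraNneq nz => f0; rewrite -coef_f f0 coef0.
  have : (#|[set t : 'I_M | root (f l) (b t)]| < J.+1)%N.
    apply: leq_trans (size_f l); apply: card_roots_lt => // t t' E.
    by apply: val_inj; apply: b_inj E; rewrite inE.
  have := cardsC [set t : 'I_M | root (f l) (b t)]; rewrite card_ord.
  rewrite (_ : ~: _ = [set t : 'I_M | (f l).[b t] != 0]); last by apply/setP => t; rewrite !inE.
  by move: #|_| #|_| => A B; lia.
have evf (l : 'I_R) (t : 'I_M) : \sum_i u i * evpt l t (newton2 (pi i) (pj i)) = (f l).[b t].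
  rewrite horner_sum; apply: eq_bigr => i _; rewrite evpt_newton2 hornerZ.
  by rewrite mulrA.
apply: (@leq_trans (\sum_(l in ~: Z) (M - J))).
  rewrite sum_nat_const leq_mul2r; apply/orP; right.
  by have := cardsC Z; rewrite card_ord; move: Z_le; move: #|_| #|_| => A B; lia.
apply: (@leq_trans (\sum_(l in ~: Z) #|[set t : 'I_M | ((f l).[b t] != 0)%R]|)).
  by apply: leq_sum => l; rewrite inE; exact: row_le.
rewrite -[X in (_ <= X)%N]sum1dep_card.
rewrite -(pair_big_dep xpredT (fun (l : 'I_R) (t : 'I_M) => \sum_i u i * evpt l t (newton2 (pi i) (pj i)) != 0) (fun _ _ => 1%N)) /=.
rewrite big_mkcond; apply: leq_sum => l _; case: ifP => // _.
rewrite -sum1dep_card leq_eqVlt; apply/orP; left; apply/eqP.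
by apply: eq_bigl => t; rewrite evf.
Qed.

End NewtonBasis.

(** * The code on the grid without its last point *)

Section GridCode.

Variables (K : finFieldType) (a b : nat -> K) (R M : nat) (g : {poly K}) (e : nat).
Hypotheses (a_inj : {in gtn R &, injective a}) (b_inj : {in gtn M &, injective b}).
Hypotheses (M_gt0 : (0 < M)%N) (M_le : (M <= #|K|)%N).
Hypotheses (g_monic : g \is monic) (size_g : size g = e.+1) (e_gt0 : (0 < e)%N).
Hypothesis co_qe : coprime #|K| e.
Hypothesis on_curve : forall l t, (l < R)%N -> (t < M)%N ->
  eval2 idfun (a l) (b t) (curve g) = 0.
Local Notation q := #|K|.
Local Notation N := (R * M).-1.
Local Notation nb := (newton2 a b).
Local Notation evpt k := (eval2 idfun (a (k %/ M)) (b (k %% M))).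

(** The same numbering k = i M + j serves for the points (a_i, b_j) and for the monomials X^i Y^j.
    Indices k < N leave out the corner (R - 1, M - 1) in both roles. *)
Definition grid_weight (k : nat) := (q * (k %/ M) + e * (k %% M))%N.

Definition grid_word f : 'rV[K]_N := \row_k evpt k f.

Definition grid_support m := [set k : 'I_N | (grid_weight k <= m)%N].

Definition grid_basis m := [tuple grid_word (nb (enum_val i %/ M) (enum_val i %% M)) |
  i < #|grid_support m|].

Definition grid_code m : {vspace 'rV[K]_N} := <<grid_basis m>>%VS.

Lemma grid_word_sum (I : Type) (r : seq I) (u : I -> K) (f : I -> {poly {poly K}}) :
  grid_word (\sum_(i <- r) (u i)%:P%:P * f i) = \sum_(i <- r) u i *: grid_word (f i).
Proof.
apply/rowP => k; rewrite mxE summxE rmorph_sum; apply: eq_bigr => i _.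
by rewrite !mxE rmorphM /= eval2C eval1C.
Qed.

Lemma grid_wordD f h : grid_word (f + h) = grid_word f + grid_word h.
Proof. by apply/rowP => k; rewrite !mxE eval2D. Qed.

Lemma grid_word_scale c f : grid_word (c%:P%:P * f) = c *: grid_word f.
Proof. by apply/rowP => k; rewrite !mxE eval2M eval2C eval1C. Qed.

Lemma mem_grid_code m k : k \in grid_support m ->
  grid_word (nb (k %/ M) (k %% M)) \in grid_code m.
Proof.
move=> km; apply: memv_span; apply/tnthP; exists (enum_rank_in km k).
by rewrite tnth_mktuple enum_rankK_in.
Qed.

(** Outside the index set the word is zero: a point k at which the Newton polynomial does not vanish
    satisfies k / M >= i and k mod M >= j, so k >= i M + j. For the corner monomial only the omitted
    point would remain. *)
Lemma grid_word_newton2 m i j : (q * i + e * j <= m)%N -> grid_word (nb i j) \in grid_code m.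
Proof.
move=> ijm; have [jM|Mj] := ltnP j M; last first.
  rewrite (_ : grid_word _ = 0) ?mem0v //; apply/rowP => k; rewrite !mxE evpt_newton2.
  by rewrite (newton_root b) ?mulr0 // (leq_trans _ Mj) // ltn_pmod.
have [ijN|Nij] := ltnP (i * M + j) N.
  have := @mem_grid_code m (Ordinal ijN); rewrite inE /grid_weight /=.
  by rewrite divnMDl // divn_small // addn0 modnMDl modn_small //; apply.
rewrite (_ : grid_word _ = 0) ?mem0v //; apply/rowP => k; rewrite !mxE evpt_newton2.
have [ki|ik] := ltnP (k %/ M) i; first by rewrite newton_root // mul0r.
have [kj|jk] := ltnP (k %% M) j; first by rewrite (newton_root b) // mulr0.
have := ltn_ord k; rewrite ltnNge (leq_trans Nij) //.
by rewrite [X in (_ <= X)%N](divn_eq k M) leq_add // leq_mul2r ik orbT.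
Qed.

(* Multiplying the Newton polynomial z_n by X gives z_(n+1) + z(n) z_n, so that the monomials can be
   traded for Newton polynomials without increasing the weight. *)
Lemma grid_word_mixed m s t i j : (q * (i + s) + e * (j + t) <= m)%N ->
  grid_word (('X^s)%:P * 'X^t * nb i j) \in grid_code m.
Proof.
elim: s i => [|s IHs] i.
  rewrite addn0; elim: t j => [|t IHt] j ijm.
    by rewrite !expr0 !mul1r grid_word_newton2 // -[j]addn0.
  have -> : ('X^0)%:P * 'X^(t.+1) * nb i j =
      ('X^0)%:P * 'X^t * nb i j.+1 + (b j)%:P%:P * (('X^0)%:P * 'X^t * nb i j) :> {poly {poly K}}.
    rewrite /newton2 newtonS rmorphM rmorphB /= map_polyX map_polyC /= !expr0 exprSr.
    by ring.
  rewrite grid_wordD grid_word_scale memvD ?memvZ ?IHt //; first by rewrite addSnnS.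
  by apply: leq_trans ijm; rewrite leq_add2l leq_mul2l leq_add2l leqnSn orbT.
move=> ijm.
have -> : ('X^(s.+1))%:P * 'X^t * nb i j =
    ('X^s)%:P * 'X^t * nb i.+1 j + (a i)%:P%:P * (('X^s)%:P * 'X^t * nb i j) :> {poly {poly K}}.
  rewrite /newton2 newtonS exprSr !rmorphM rmorphB /=.
  by ring.
rewrite grid_wordD grid_word_scale memvD ?memvZ ?IHs //; first by rewrite addSnnS.
by apply: leq_trans ijm; rewrite leq_add2r leq_mul2l leq_add2l leqnSn orbT.
Qed.

Lemma grid_word_wle m f : wle e m f -> grid_word f \in grid_code m.
Proof.
move=> fm.
have -> : f = \sum_(j < size f) \sum_(i < size f`_j) (f`_j`_i)%:P%:P * (('X^i)%:P * 'X^j).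
  rewrite -[LHS]coefK poly_def; apply: eq_bigr => j _.
  rewrite -mul_polyC -[in LHS](coefK f`_j) poly_def rmorph_sum mulr_suml.
  by apply: eq_bigr => i _ /=; rewrite mulrA -polyCM; congr (_%:P * _); rewrite mul_polyC.
have C0 : grid_word 0 \in grid_code m.
  by rewrite -[0](mul0r 0) -polyC0 -polyC0 grid_word_scale scale0r mem0v.
have CD f1 f2 : grid_word f1 \in grid_code m -> grid_word f2 \in grid_code m ->
    grid_word (f1 + f2) \in grid_code m by rewrite grid_wordD; exact: memvD.
apply: (big_ind (fun f1 => grid_word f1 \in grid_code m)) => // j _.
apply: (big_ind (fun f1 => grid_word f1 \in grid_code m)) => // i _.
rewrite grid_word_scale.
have [->|/fm ijm] := eqVneq (f`_j`_i) 0; first by rewrite scale0r mem0v.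
apply: memvZ; have := @grid_word_mixed m i j 0 0.
have -> : nb 0 0 = 1 by rewrite /newton2 /newton !big_ord0 polyC1 mul1r rmorph1.
by rewrite !add0n mulr1; apply.
Qed.

Lemma grid_point (k : 'I_N) : (k %/ M < R)%N.
Proof.
by rewrite ltn_divLR // (leq_trans (ltn_ord k)) // leq_pred.
Qed.

Definition grid_comb m (u : 'I_#|grid_support m| -> K) : 'rV[K]_N :=
  \sum_i u i *: grid_word (nb (enum_val i %/ M) (enum_val i %% M)).

Lemma grid_code_sum m c : c \in grid_code m ->
  c = grid_comb (fun i => coord (grid_basis m) i c).
Proof.
move=> /coord_span {1}->; apply: eq_bigr => i _.
by rewrite -tnth_nth tnth_mktuple.
Qed.

(** Identifies the span of the grid monomials with the evaluation of all polynomials of weighted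
    degree at most m, of any X-degree: reduction modulo the curve changes no value at the points. *)
Lemma grid_codeP m c :
  c \in grid_code m <-> exists2 f, (wdeg g e f <= m)%N & c = grid_word f.
Proof.
split=> [/grid_code_sum ->|[f fm ->]].
  rewrite /grid_comb -grid_word_sum; eexists; last by [].
  apply: (wdeg_le g_monic size_g e_gt0 co_qe); apply: wle_sum => i _.
  have := enum_valP i; rewrite inE; set k := enum_val i => km.
  apply: (@wle_mono _ _ (0 + grid_weight k)); first exact: km.
  apply: wleM => [j l|].
    rewrite coefC; case: (l =P 0%N) => [->|_]; last by rewrite coef0 eqxx.
    rewrite coefC; case: (j =P 0%N) => [->|_]; last by rewrite eqxx.
    by rewrite !muln0.
  exact: wle_newton2.
have -> : grid_word f = grid_word (rmodp f (curve g)).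
  apply/rowP => k; rewrite !mxE [in LHS](rdivp_eq (curve_monic g) f) eval2D eval2M.
  by rewrite on_curve ?mulr0 ?add0r ?ltn_pmod // grid_point.
apply: grid_word_wle => i j nz; apply: leq_trans fm.
exact: wle_wdeg nz.
Qed.

(** The successor pays for the omitted corner of the grid, where the function may also be
    nonzero. *)
Lemma grid_weight_bound m (u : 'I_#|grid_support m| -> K) : (exists i, u i != 0) ->
  exists2 k, k \in grid_support m & ((R - k %/ M) * (M - k %% M) <=
    #|[set l | grid_comb u 0%R l != 0%R]|.+1)%N.
Proof.
move=> u_nz.
have [|i _ i_le] := @newton2_weight K a b R M _ (fun i : 'I_#|grid_support m| => enum_val i %/ M)%N
    (fun i => enum_val i %% M)%N u a_inj b_inj _ u_nz.
  move=> i j [E1 E2]; apply: enum_val_inj; apply: val_inj.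
  by rewrite /= (divn_eq (enum_val i) M) E1 E2 -divn_eq.
exists (enum_val i); first exact: enum_valP.
apply: (leq_trans i_le); set B := [set l : 'I_N | _]; set A := [set _ | _].
pose h (p : 'I_R * 'I_M) := (p.1 * M + p.2)%N.
have h_div p : (h p %/ M = p.1)%N by rewrite divnMDl // divn_small ?addn0.
have h_mod p : (h p %% M = p.2)%N by rewrite modnMDl modn_small.
have h_inj : injective h.
  move=> p p' E; case: p p' E (h_div p) (h_mod p) (h_div p') (h_mod p') => [l t] [l' t'] E.
  by rewrite E => -> -> /= l_eq t_eq; congr pair; apply: val_inj.
have h_lt p : (h p < R * M)%N.
  have := ltn_ord p.1; have := ltn_ord p.2; rewrite /h => tM lR.
  apply: (@leq_trans (p.1.+1 * M)); first by rewrite mulSn addnC ltn_add2r.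
  by rewrite leq_mul2r lR orbT.
(* Only the pair numbered R M - 1 is not a coordinate. *)
rewrite -(cardsID [set p | (h p < N)%N] A) -addn1; apply: leq_add; last first.
  apply/card_le1P => p; rewrite !inE -leqNgt => /andP[pN pA] p'; rewrite !inE.
  apply/andP/eqP => [[p'N _]|->]; last by rewrite -leqNgt.
  apply: h_inj; move: (h_lt p) (h_lt p') pN p'N; move: (h p) (h p') (R * M)%N; clear; lia.
pose f p : option 'I_N := insub (h p).
have f_inj : {in A :&: [set p | (h p < N)%N] &, injective f}.
  move=> p p'; rewrite !inE => /andP[_ pN] /andP[_ p'N].
  by rewrite /f !insubT => [[]] /h_inj.
rewrite -(card_in_imset f_inj) -(card_imset B (@Some_inj _)); apply: subset_leq_card.
apply/subsetP => o /imsetP[p]; rewrite !inE => /andP[pA pN] ->.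
rewrite /f insubT; apply/imsetP; exists (Ordinal pN) => //; rewrite inE.
apply: contraNneq pA => E; apply/eqP; rewrite -[RHS]E summxE.
by apply: eq_bigr => k _; rewrite !mxE /= h_div h_mod.
Qed.

(** A nonzero combination of the generators has weight at least D > 0, which yields their
    independence and the distance at once. The strict inequality in the hypothesis absorbs the
    missing point. *)
Lemma grid_code_params m D : (0 < D)%N ->
  (forall k, k \in grid_support m -> D < (R - k %/ M) * (M - k %% M))%N ->
  \dim (grid_code m) = #|grid_support m| /\
  forall v w, v \in grid_code m -> w \in grid_code m -> v != w -> (D <= hamming_distance v w)%N.
Proof.
move=> D_gt0 D_lt.
have weight (u : 'I_#|grid_support m| -> K) : (exists i, u i != 0) -> (D <=
    #|[set l | grid_comb u 0%R l != 0%R]|)%N.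
  move=> /(@grid_weight_bound m)[k /D_lt kD le].
  by rewrite -ltnS (leq_trans kD).
split.
  rewrite -[RHS](size_tuple (grid_basis m)); apply/eqP; apply/freeP => u u0 i.
  apply/eqP; apply: contraT => ui; have /weight := ex_intro (fun i => u i != 0) i ui.
  rewrite leqNgt (_ : [set _ | _] = set0) ?cards0 ?D_gt0 //; apply/setP => l; rewrite !inE.
  rewrite (_ : grid_comb u = 0) ?mxE ?eqxx // -[RHS]u0; apply: eq_bigr => k _.
  by rewrite -tnth_nth tnth_mktuple.
move=> v w vC wC vw; have := memvB vC wC => /grid_code_sum E.
have [/weight|ui] := pselect (exists i, coord (grid_basis m) i (v - w) != 0); last first.
  case/eqP: vw; apply/eqP; rewrite -subr_eq0 E /grid_comb big1 // => i _.
  by have [->|nz] := eqVneq (coord (grid_basis m) i (v - w)) 0; [rewrite scale0r|case: ui; exists i].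
rewrite -E /hamming_distance.
by rewrite (_ : [set l | _] = [set i | v 0 i != w 0 i]) //; apply/setP => l; rewrite !inE !mxE subr_eq0.
Qed.

Lemma grid_weight_inj (k k' : 'I_N) : grid_weight k = grid_weight k' -> k = k'.
Proof.
have lt (l : nat) : (l %% M < q)%N by rewrite (leq_trans (ltn_pmod _ M_gt0)).
move=> /(weight_inj co_qe (lt _) (lt _))[E1 E2].
by apply: val_inj; rewrite /= (divn_eq k M) E1 E2 -divn_eq.
Qed.

End GridCode.

(** A discrete intermediate value argument: with distinct weights, raising m by one admits at most
    one new index. This is how the dimension is prescribed exactly. *)
Lemma threshold_count (n : nat) (w : 'I_n -> nat) (k : nat) : injective w -> (0 < k <= n)%N ->
  exists m, #|[set i | (w i <= m)%N]| = k.
Proof.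
move=> w_inj /andP[k_gt0 kn].
have ex : exists m, (k <= #|[set i | (w i <= m)%N]|)%N.
  exists (\max_i w i); rewrite (_ : [set i | _] = setT) ?cardsT ?card_ord //.
  by apply/setP => i; rewrite !inE leq_bigmax.
case: (ex_minnP ex) => m km m_min; exists m; apply/eqP; rewrite eqn_leq km andbT.
have one : (#|[set i | w i == m]| <= 1)%N.
  apply/card_le1P => i; rewrite inE => /eqP im i'; rewrite !inE -im.
  by apply/eqP/eqP => [/w_inj|->].
case: m km m_min one => [|m] km m_min one.
  by rewrite (_ : [set i | _] = [set i | w i == 0%N]) ?(leq_trans one) //; apply/setP => i; rewrite !inE leqn0.
have lt : (#|[set i | (w i <= m)%N]| < k)%N.
  by rewrite ltnNge; apply/negP => /m_min; rewrite ltnn.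
rewrite (_ : [set i | (w i <= m.+1)%N] = [set i | (w i <= m)%N] :|: [set i | w i == m.+1]); last first.
  by apply/setP => i; rewrite !inE leq_eqVlt orbC.
by rewrite (leq_trans (leq_card_setU _ _)) // -ltnS -addn1; lia.
Qed.

(** * The grid code as a one-point AG code *)

Section GridCodeAG.

Variables (K : finFieldType) (a b : nat -> K) (R M : nat) (g : {poly K}) (e : nat).
Hypotheses (a_inj : {in gtn R &, injective a}) (b_inj : {in gtn M &, injective b}).
Hypotheses (R_gt0 : (0 < R)%N) (M_gt0 : (0 < M)%N).
Hypotheses (g_monic : g \is monic) (size_g : size g = e.+1) (e_gt0 : (0 < e)%N).
Hypothesis co_qe : coprime #|K| e.
Hypothesis on_curve : forall l t, (l < R)%N -> (t < M)%N ->
  eval2 idfun (a l) (b t) (curve g) = 0.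
Local Notation N := (R * M).-1.

Lemma grid_code_AG m : is_AG_code (grid_code a b R M e m).
Proof.
have [F [iota [x [y curve_field]]]] := curve_field_exists g_monic size_g e_gt0 co_qe.
have [Pinf PinfE] := infinite_place g_monic size_g e_gt0 co_qe curve_field.
have pole_x := vge_Pinf_x g_monic size_g e_gt0 co_qe curve_field PinfE.
exists F, iota; split.
- exact: curve_is_function_field PinfE.
- have [P [_ res _ _]] := rational_place_exists curve_field (on_curve R_gt0 M_gt0).
  exact: full_constant_field_residue res.
have on_curve_k (k : 'I_N) : eval2 idfun (a (k %/ M)) (b (k %% M)) (curve g) = 0.
  by rewrite on_curve ?ltn_pmod // grid_point.
pose Pk k := projT1 (cid (rational_place_exists curve_field (on_curve_k k))).
have PkP k : [/\ rational_place (Pk k), forall z, vge (Pk k) 0 z -> exists c, vge (Pk k) 1 (z - iota c),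
    vge (Pk k) 0 x & forall f, value_at (Pk k) (eval2 iota x y f)
      (eval2 idfun (a (k %/ M)) (b (k %% M)) f)].
  exact: projT2 (cid (rational_place_exists curve_field (on_curve_k k))).
(* The values of x and y at the place recover the point, hence the index. *)
have Pk_inj : injective Pk.
  move=> k k' E; have [_ _ _ val] := PkP k; have [_ _ _ val'] := PkP k'; rewrite E in val.
  have := value_at_unique (val 'X%:P) (val' 'X%:P); rewrite !eval2C !eval1X => Ea.
  have := value_at_unique (val 'X) (val' 'X); rewrite !eval2X => Eb.
  apply: val_inj; rewrite /= (divn_eq k M) (divn_eq k' M).
  by rewrite (a_inj _ _ Ea) ?inE ?grid_point // (b_inj _ _ Eb) ?inE ?ltn_pmod.
exists [tuple Pk k | k < N], << m%:Z *g Pinf >>; split.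
- by rewrite map_inj_uniq ?enum_uniq.
- by move=> i; rewrite tnth_mktuple; have [] := PkP i.
- move=> i; rewrite tnth_mktuple mem_dom coeffU negbK mulf_eq0; apply/orP; right.
  case: (Pinf =P Pk i) => [E|//]; have [_ _ Px _] := PkP i.
  by rewrite E Px in pole_x.
left=> c; rewrite (grid_codeP M_gt0 g_monic size_g e_gt0 co_qe on_curve).
split=> [[f fm ->]|[z /(RR_pole_divisor g_monic size_g e_gt0 co_qe curve_field PinfE)[f fm ->] zc]].
  exists (eval2 iota x y f).
    exact: (pole_divisor_RR g_monic size_g e_gt0 co_qe curve_field PinfE).
  by move=> i; rewrite tnth_mktuple mxE; have [] := PkP i.
exists f => //; apply/rowP => i; rewrite mxE; have [_ _ _ val] := PkP i.
by apply: (value_at_unique _ (val f)); have := zc i; rewrite tnth_mktuple.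
Qed.

End GridCodeAG.

(** * Counting heavy monomials and choosing the parameters *)

Lemma minimum_distance_exists (K : finFieldType) (N D : nat) (C : {vspace 'rV[K]_N}) :
  (0 < \dim C)%N ->
  (forall v w, v \in C -> w \in C -> v != w -> (D <= hamming_distance v w)%N) ->
  exists2 d, (D <= d)%N & minimum_distance C d.
Proof.
move=> C_gt0 D_le.
pose Q d := `[< exists x y, [/\ x \in C, y \in C, x != y & hamming_distance x y = d] >].
have ex : exists d, Q d.
  exists (hamming_distance (vpick C) 0); apply/asboolP; exists (vpick C), 0.
  by rewrite memv_pick mem0v vpick0 -dimv_eq0 -lt0n.
case: (ex_minnP ex) => d /asboolP[x [y [xC yC xy xyd]]] d_min.
exists d; first by rewrite -xyd; exact: D_le.
split; first by exists x, y.
by move=> v w vC wC vw; apply: d_min; apply/asboolP; exists v, w.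
Qed.

Lemma card_lower_bound (M lo : nat) (A : {set 'I_M}) :
  (forall j, j \in A -> (lo <= j)%N) -> (#|A| <= M - lo)%N.
Proof.
move=> lo_le; have [Mlo|loM] := leqP M lo.
  rewrite (_ : A = set0) ?cards0 //; apply/setP => j; rewrite inE; apply/negP => /lo_le.
  by have := ltn_ord j; lia.
have f_lt (j : 'I_M) : (j - lo < (M - lo).-1.+1)%N by have := ltn_ord j; lia.
have f_inj : {in A &, injective (fun j => Ordinal (f_lt j))}.
  by move=> j j' /lo_le h /lo_le h' [E]; apply: val_inj => /=; lia.
by rewrite -(card_in_imset f_inj) (leq_trans (max_card _)) // card_ord; lia.
Qed.

(** The redundancy counts the grid monomials heavier than m, and those of X-degree i lie in the
    interval from [lo i] to M. *)
Lemma grid_support_count (K : finFieldType) (R M e m : nat) (lo : nat -> nat) : (0 < M)%N ->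
  (forall i j, (i < R)%N -> (j < M)%N -> (m < #|K| * i + e * j)%N -> (lo i <= j)%N) ->
  ((R * M).-1 - #|grid_support K R M e m| <= \sum_(i < R) (M - lo i))%N.
Proof.
move=> M_gt0 lo_le; set T := grid_support _ _ _ _ _.
have -> : ((R * M).-1 - #|T| = #|~: T|)%N by have E := cardsC T; rewrite card_ord in E; rewrite -[X in (X - _)%N]E addKn.
pose A (i : 'I_R) := [set j : 'I_M | (m < #|K| * i + e * j)%N].
apply: (@leq_trans (\sum_(i < R) #|A i|)); last first.
  by apply: leq_sum => i _; apply: card_lower_bound => j; rewrite inE; exact: lo_le.
under eq_bigr => i _ do rewrite -sum1dep_card.
rewrite (pair_big_dep xpredT (fun i j => (m < #|K| * nat_of_ord i + e * nat_of_ord j)%N) (fun _ _ => 1%N)) /=.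
rewrite sum1dep_card.
have div_lt (k : 'I_(R * M).-1) := @grid_point R M M_gt0 k.
pose f (k : 'I_(R * M).-1) := (Ordinal (div_lt k), Ordinal (ltn_pmod k M_gt0)).
have f_inj : injective f.
  by move=> k k' [E1 E2]; apply: val_inj; rewrite /= (divn_eq k M) E1 E2 -divn_eq.
rewrite -(card_imset _ f_inj); apply: subset_leq_card; apply/subsetP => p /imsetP[k kT ->].
by move: kT; rewrite !inE /grid_weight -ltnNge.
Qed.

(* With q = s^2 and e = 6 s + 1, one step in X weighs as much as about s / 6 steps in Y. *)
Lemma weight_step (s i i' j j' : nat) : (s * s * i + (6 * s + 1) * j < s * s * i' + (6 * s + 1) * j')%N ->
  (if (i' <= i)%N then j + ((i - i') * s.-1) %/ 6 < j' else j - (s * (i' - i)) %/ 6 <= j')%N.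
Proof.
(* Both roundings are on the safe side: x = floor(d (s - 1) / 6) satisfies (6 s + 1) x <= s^2 d,
   where s - 1 compensates the extra 1 in e, and x = floor(s d / 6) satisfies s^2 d < (6 s + 1) (x +
   1). *)
move=> lt; case: (leqP i' i) => [i'i|ii'].
  rewrite ltnNge; apply/negP => le; move: lt; rewrite -(subnK i'i).
  move: (i - i')%N le => d le lt; move: le (leq_divM (d * s.-1) 6).
  move: (_ %/ 6)%N => x le x_le.
  have := leq_mul (leqnn (6 * s + 1)) x_le; have := leq_mul (leqnn (6 * s + 1)) le.
  by case: s lt x_le => [|s] lt x_le /=; move: lt; clear; nia.
rewrite leqNgt; apply/negP => le; move: lt; rewrite -(subnK (ltnW ii')).
move: (i' - i)%N le => d le lt; move: le (ltn_ceil (s * d) (ltn0Sn 5)).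
move: (_ %/ 6)%N => x le x_lt.
have le' : (j' + x + 1 <= j)%N by lia.
have := leq_mul (leqnn (6 * s + 1)) le'; have := leq_mul (leqnn s) x_lt.
by move: lt; clear; nia.
Qed.

(** By contradiction: [lo i] bounds from below the Y-degree of the monomials of X-degree i heavier
    than m. If (4 - i0) (M - j0) were at most s/2 + 12, the four rows would hold, up to constants,
    at most 3s/2, s, 3s/4 or s of them for i0 = 0, 1, 2, 3, against a redundancy of at least 37s/20
    + 38/5. The bound v >= 16 absorbs the constants. *)
Lemma grid_distance_bound (K : finFieldType) (v m : nat) :
  let s := (4 * v)%N in let M := (s * s - 2 * s)%N in
  (16 <= v)%N -> #|K| = (s * s)%N ->
  (37 * s + 152 <= 20 * ((4 * M).-1 - #|grid_support K 4 M (6 * s + 1) m|))%N ->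
  forall k, k \in grid_support K 4 M (6 * s + 1) m ->
  (2 * v + 12 < (4 - k %/ M) * (M - k %% M))%N.
Proof.
move=> s M v_ge qE red k; rewrite inE /grid_weight qE => km.
have M_gt0 : (0 < M)%N by rewrite /M /s; nia.
have i0_lt := grid_point M_gt0 k; have j0_lt := ltn_pmod k M_gt0.
move: (k %/ M)%N (k %% M)%N i0_lt j0_lt km => i0 j0 i0_lt j0_lt km.
pose lo i := if (i <= i0)%N then (j0 + ((i0 - i) * s.-1) %/ 6).+1 else (j0 - (s * (i - i0)) %/ 6)%N.
have lo_le i j : (i < 4)%N -> (j < M)%N -> (m < #|K| * i + (6 * s + 1) * j)%N -> (lo i <= j)%N.
  move=> _ _; rewrite qE => /(leq_ltn_trans km)/weight_step; rewrite /lo.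
  by case: ifP.
have := leq_trans red (leq_mul (leqnn 20) (grid_support_count M_gt0 lo_le)).
rewrite -(big_mkord xpredT (fun i => (M - lo i)%N)) 4?big_ltn // big_geq // /lo /=.
rewrite ltnNge => le; apply/negP => bad; move: le bad.
clear lo_le red km k M_gt0; move: (M) j0_lt; rewrite /s => {M} M j0_lt.
case: i0 i0_lt {lo qE s} => [|[|[|[|i0]]]] // _ /=.
- by lia.
- by lia.
- by lia.
by lia.
Qed.

Lemma AG_code_exists (K : finFieldType) (v r : nat) :
  let s := (4 * v)%N in let N := (4 * (s * s - 2 * s)).-1 in
  (16 <= v)%N -> #|K| = (s * s)%N -> (37 * s + 152 <= 20 * r)%N -> (r < N)%N ->
  exists d (C : {vspace 'rV[K]_N}),
    [/\ is_AG_code C, code_parameters C (N - r) d & (2 * v + 12 <= d)%N].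
Proof.
move=> s N v_ge qE red rN; pose M := (s * s - 2 * s)%N; pose e := (6 * s + 1)%N.
have M_gt0 : (0 < M)%N by rewrite /M /s; nia.
have M_le : (M <= #|K|)%N by rewrite qE leq_subr.
have four_le : (4 <= #|K|)%N by rewrite qE /s; nia.
have e_gt0 : (0 < e)%N by rewrite /e addn1.
have co_qe : coprime #|K| e.
  by rewrite qE coprimeMl andbb /e /coprime gcdnMDl gcdn1.
pose a l := nth 0 (enum K) l.
have a_inj n : (n <= #|K|)%N -> {in gtn n &, injective a}.
  move=> nq l l'; rewrite !inE => ln l'n /eqP.
  by rewrite nth_uniq ?enum_uniq -?cardE ?(leq_trans _ nq) // => /eqP.
(* The vanishing of g at four elements of K puts all points above them on the curve, as b^q = b in
   K; the power of X brings the degree up to e. *)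
pose g : {poly K} := 'X^(e - 4) * newton a 4.
have g_monic : g \is monic by rewrite monicMl ?newton_monic ?monicXn.
have size_g : size g = e.+1.
  rewrite size_Mmonic ?monic_neq0 ?monicXn ?newton_monic // size_polyXn size_newton.
  by rewrite /e /s; lia.
have on_curve l t : (l < 4)%N -> (t < M)%N -> eval2 idfun (a l) (a t) (curve g) = 0.
  move=> l4 _; rewrite /curve !eval2B eval2Xn eval2X eval2C expf_card subrr sub0r.
  by rewrite eval1_id hornerM newton_root // mulr0 oppr0.
have w_inj : injective (fun k : 'I_N => grid_weight K M e k).
  by move=> k k'; exact: (grid_weight_inj (R := 4) M_gt0 M_le co_qe).
have [|m mE] := @threshold_count N _ (N - r) w_inj.
  by rewrite subn_gt0 rN leq_subr.
have supp : #|grid_support K 4 M e m| = (N - r)%N by exact: mE.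
have D_lt : forall k, k \in grid_support K 4 M e m ->
    (2 * v + 12 < (4 - k %/ M) * (M - k %% M))%N.
  apply: grid_distance_bound => //; rewrite supp -/N subKn // ltnW //.
have D_gt0 : (0 < 2 * v + 12)%N by rewrite addnS.
have [dimC distC] := grid_code_params (a_inj _ four_le) (a_inj _ M_le) M_gt0 D_gt0 D_lt.
have [|d dD dmin] := minimum_distance_exists _ distC.
  by rewrite dimC supp subn_gt0.
exists d, (grid_code a a 4 M e m); split.
- exact: (grid_code_AG (a_inj _ four_le) (a_inj _ M_le) _ M_gt0 g_monic size_g e_gt0 co_qe on_curve).
- by split=> //; rewrite dimC supp.
- by [].
Qed.

Theorem proposition6p3 (n u : nat) (hn3 : (3 <= n)%N) (hodd : odd n)
    (hu : u = (2 ^ n)%N) (K : finFieldType) (hK : #|K| = (u ^ 4)%N)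
    (c1 c2 : int)
    (hc1l : (4 * u%:R ^+ 2 + 9) / 5 <= c1%:~R :> rat)
    (hc1u : c1%:~R <= (11 * u%:R ^+ 2 + 4) / 12 :> rat)
    (hc2l : (4 * u%:R ^+ 2 + 9) / 5 <= c2%:~R :> rat)
    (hc2u : c2%:~R <= (5 * u%:R ^+ 2 + 4) / 6 :> rat) :
  exists (N k d : nat) (C : {vspace 'rV[K]_N}),
    [/\ is_AG_code C, code_parameters C k d,
        N%:R = 4 * u%:R ^+ 4 - 8 * u%:R ^+ 2 - 1 :> rat,
        k%:R = 4 * u%:R ^+ 4 - 33 * u%:R ^+ 2 / 4 - 5
               - c1%:~R - c2%:~R :> rat &
        u%:R ^+ 2 / 2 + 12 <= d%:R :> rat].
Proof.
(* v = (u / 2)^2, so that s = u^2 and both s / 4 and s / 2 are integers; n >= 3 gives v >= 16. *)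
pose v := (2 ^ n.-1 * 2 ^ n.-1)%N; pose s := (4 * v)%N.
have v_ge : (16 <= v)%N.
  by rewrite (@leq_mul 4 4) // (@leq_exp2l 2 2) // -ltnS prednK // (leq_trans _ hn3).
have sE : (u ^ 2 = s)%N.
  have -> : u = (2 * 2 ^ n.-1)%N by rewrite hu -expnS prednK // (leq_trans _ hn3).
  by rewrite /s /v expnMn -[X in (_ * X)%N]mulnn.
have qE : #|K| = (s * s)%N by rewrite hK -sE mulnn -expnM.
have sR : u%:R ^+ 2 = s%:R :> rat by rewrite -natrX sE.
have sR4 : u%:R ^+ 4 = s%:R ^+ 2 :> rat by rewrite -sR -exprM.
rewrite !sR sR4 in hc1l hc1u hc2l hc2u *.
have [h1l h1u h2l h2u] :
    [/\ (4 * s + 9)%:Z <= 5%:Z * c1, 12%:Z * c1 <= (11 * s + 4)%:Z,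
        (4 * s + 9)%:Z <= 5%:Z * c2 & 6%:Z * c2 <= (5 * s + 4)%:Z].
  by split; rewrite -(ler_int rat) intrM -!pmulrn natrD natrM; lra.
have [a1 a1E] : exists a1 : nat, c1 = a1%:Z by exists (absz c1); lia.
have [a2 a2E] : exists a2 : nat, c2 = a2%:Z by exists (absz c2); lia.
(* The redundancy N - k, with u^2 / 4 = v. The lower bounds on c1 and c2 give 20 r >= (5 s + 80) +
   (32 s + 72), and the upper bounds keep r below N. *)
pose r := (v + 4 + a1 + a2)%N.
have [||d [C [CAG Cp d_ge]]] := @AG_code_exists K v r v_ge qE.
- by rewrite /r; lia.
- by rewrite /r -/s; nia.
have sv : s%:R = 4 * v%:R :> rat by rewrite -natrM.
have N_eq : ((4 * (s * s - 2 * s)).-1 + 1 + 8 * s = 4 * (s * s))%N by rewrite /s; nia.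
have r_lt : (r < (4 * (s * s - 2 * s)).-1)%N by rewrite /r; nia.
have NR : ((4 * (s * s - 2 * s)).-1)%:R = 4 * s%:R ^+ 2 - 8 * s%:R - 1 :> rat.
  by have := congr1 (fun k => k%:R : rat) N_eq; rewrite !natrD !natrM; lra.
exists (4 * (s * s - 2 * s)).-1, ((4 * (s * s - 2 * s)).-1 - r)%N, d, C; split; [exact: CAG | exact: Cp | exact: NR | |].
  by rewrite natrB ?(ltnW r_lt) // NR /r !natrD a1E a2E; lra.
have dR : (2 * v + 12)%:R <= d%:R :> rat by rewrite ler_nat.
by rewrite natrD natrM in dR; lra.
Qed.
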